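(* Let $\rho$ be any state on $\mathcal{H}_{AB}=\mathcal{H}_A\otimes\mathcal{H}_B$, let $d_A=\dim\mathcal{H}_A$, let $\Omega$ be the convex set of symmetric extendible states on $\mathcal{H}_{AB}$, and let $$\epsilon=\inf_{\sigma\in\Omega}\|\rho-\sigma\|_1$$ (with $\epsilon\le1$) be the trace-norm distance of $\rho$ to the nearest symmetric extendible state. Then $$K^{(1)}_{\rightarrow}(\rho)\leq 8\epsilon\log d_A+4\eta(1-\epsilon)+4\eta(\epsilon).$$
   Context: Hilbert spaces are finite-dimensional; $\|\cdot\|_1$ is the trace norm; $\log$ is base $2$; $\eta(x)=-x\log x$ for $0<x\le 1$ and $\eta(0)=0$. A state $\rho_{AB}$ on $\mathcal{H}_A\otimes\mathcal{H}_B$ is symmetric extendible if there is a state $\rho_{ABB'}$ on $\mathcal{H}_A\otimes\mathcal{H}_B\otimes\mathcal{H}_{B'}$, $\mathcal{H}_{B'}\cong\mathcal{H}_B$, invariant under conjugation by the swap of $B$ and $B'$, with $\mathrm{Tr}_{B'}\rho_{ABB'}=\rho_{AB}$. For a state $\rho$ on $\mathcal{H}_A\otimes\mathcal{H}_B$ let $\rho_{ABE}$ be a purification of $\rho$, with $E$ the eavesdropper's system. The one-copy one-way secret key quantity is $$K^{(1)}_{\rightarrow}(\rho)=\max_{Q,\,T|X}\big[I(X:B|T)-I(X:E|T)\big],$$ where the maximum is over all POVMs $Q=(Q_x)_{x\in\mathcal{X}}$ on $\mathcal{H}_A$ and all classical channels $R$ with $T=R(X)$ (one may assume $|\mathcal{X}|\le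 d_A^2$ and $|T|\le d_A^2$), and the conditional quantum mutual informations are evaluated on the state $$\omega_{TXBE}=\sum_{t,x}R(t|x)\,|t\rangle\langle t|_T\otimes|x\rangle\langle x|_X\otimes\mathrm{Tr}_A\big(\rho_{ABE}(Q_x\otimes I_{BE})\big).$$ Here $I(X:Y|T)=S(XT)+S(YT)-S(XYT)-S(T)$ with $S$ the von Neumann entropy. *)

(* Defs.v *)
From mathcomp Require Import all_boot all_order all_algebra.
From mathcomp Require Import mxtens complex.
From mathcomp Require Import all_classical all_reals all_analysis.

Set Implicit Arguments.
Unset Strict Implicit.
Unset Printing Implicit Defensive.

Import Order.TTheory GRing.Theory Num.Theory.

Local Open Scope classical_set_scope.
Local Open Scope complex_scope.
Local Open Scope sesquilinear_scope.
Local Open Scope ring_scope.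

(* Operators on C^m (x) C^n are matrices of size m * n, with the index
   convention of [mxtens_index] (the one behind the Kronecker product [*t]).
   Multipartite systems are bracketed to the right: A (x) (B (x) E). *)

Section Operators.
Context {R : realType}.
Local Notation C := (R[i]).

Definition psdmx n (A : 'M[C]_n) : Prop :=
  forall v : 'cV[C]_n, 0 <= (v ^t* *m A *m v) 0 0.

Definition state n (rho : 'M[C]_n) : Prop := psdmx rho /\ \tr rho = 1.

(* Sum of the singular values, i.e. tr |X| where |X|^2 = X^* X. *)
Definition trnorm n (X : 'M[C]_n) : R :=
  \sum_(i < n) Num.sqrt (complex.Re (spectral_diag (X ^t* *m X) 0 i)).

Definition ptrace_l m n (A : 'M[C]_(m * n)) : 'M[C]_n :=
  \matrix_(i, j) \sum_(k < m) A (mxtens_index (k, i)) (mxtens_index (k, j)).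

Definition ptrace_r m n (A : 'M[C]_(m * n)) : 'M[C]_m :=
  \matrix_(i, j) \sum_(k < n) A (mxtens_index (i, k)) (mxtens_index (j, k)).

(* The map id (x) Phi: Phi is applied to each of the m x m blocks of A. *)
Definition on_r m n p (Phi : 'M[C]_n -> 'M[C]_p) (A : 'M[C]_(m * n)) :
    'M[C]_(m * p) :=
  \matrix_(i, j)
    Phi (\matrix_(k, l) A (mxtens_index ((mxtens_unindex i).1, k))
                          (mxtens_index ((mxtens_unindex j).1, l)))
        (mxtens_unindex i).2 (mxtens_unindex j).2.

Definition swapmx n : 'M[C]_(n * n) :=
  \matrix_(i, j)
    (mxtens_unindex i == ((mxtens_unindex j).2, (mxtens_unindex j).1))%:R.

Definition symmetric_extendible dA dB (sigma : 'M[C]_(dA * dB)) : Prop :=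
  exists tau : 'M[C]_(dA * (dB * dB)),
    let F := (1%:M : 'M[C]_dA) *t swapmx dB in
    [/\ state tau, F *m tau *m F ^t* = tau & on_r (@ptrace_r dB dB) tau = sigma].

Definition symext_dist dA dB (rho : 'M[C]_(dA * dB)) : R :=
  inf [set trnorm (rho - sigma) | sigma in @symmetric_extendible dA dB].

Definition purification dA dB dE (rho : 'M[C]_(dA * dB))
    (rhoABE : 'M[C]_(dA * (dB * dE))) : Prop :=
  (exists psi : 'cV[C]_(dA * (dB * dE)), rhoABE = psi *m psi ^t*) /\
  on_r (@ptrace_r dB dE) rhoABE = rho.

Definition log2 (x : R) : R := ln x / ln 2.

Definition eta (x : R) : R := if x == 0 then 0 else - (x * log2 x).

(* Von Neumann entropy - tr (rho log rho), read off from the eigenvalues. *)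
Definition vN_entropy n (rho : 'M[C]_n) : R :=
  \sum_(i < n) eta (complex.Re (spectral_diag rho 0 i)).

(* I(X:Y|T) of an operator on T (x) (X (x) Y). *)
Definition cond_mutual_info t x y (w : 'M[C]_(t * (x * y))) : R :=
  vN_entropy (on_r (@ptrace_r x y) w) + vN_entropy (on_r (@ptrace_l x y) w)
  - vN_entropy w - vN_entropy (ptrace_r w).

Definition POVM n d (Q : 'I_n -> 'M[C]_d) : Prop :=
  (forall x, psdmx (Q x)) /\ \sum_x Q x = 1%:M.

(* W x t is the probability of the output t on the input x. *)
Definition channel n m (W : 'I_n -> 'I_m -> R) : Prop :=
  (forall x t, 0 <= W x t) /\ (forall x, \sum_t W x t = 1).

Definition cq_state dA dB dE n m (rhoABE : 'M[C]_(dA * (dB * dE)))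
    (Q : 'I_n -> 'M[C]_dA) (W : 'I_n -> 'I_m -> R) :
    'M[C]_(m * (n * (dB * dE))) :=
  \sum_t \sum_x
    (W x t)%:C *: ((delta_mx t t : 'M[C]_m) *t
      ((delta_mx x x : 'M[C]_n) *t
        ptrace_l (rhoABE *m (Q x *t (1%:M : 'M[C]_(dB * dE)))))).

(* I(X:B|T) - I(X:E|T) on an operator on T (x) (X (x) (B (x) E)). *)
Definition key_gain m n dB dE (w : 'M[C]_(m * (n * (dB * dE)))) : R :=
  cond_mutual_info (on_r (on_r (@ptrace_r dB dE)) w)
  - cond_mutual_info (on_r (on_r (@ptrace_l dB dE)) w).

(* The alphabets are arbitrary finite sets {0, .., n-1} and {0, .., m-1}; the
   supremum lives in the extended reals, so no boundedness is presupposed. *)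
Definition one_way_key dA dB dE (rhoABE : 'M[C]_(dA * (dB * dE))) : \bar R :=
  ereal_sup [set v | exists n m (Q : 'I_n -> 'M[C]_dA) (W : 'I_n -> 'I_m -> R),
    [/\ POVM Q, channel W & v = (key_gain (cq_state rhoABE Q W))%:E]].

End Operators.

(* Main.v *)
(* Work with unnormalised states and let S(A|B) = S(AB) - S(B). Since rho_ABE is
   pure, the quantity to be maximised equals
     sum_x S(A|B)_{Q_x^1/2 rho Q_x^1/2} - sum_t S(A|B)_{M_t^1/2 rho M_t^1/2}
   with M_t = sum_x R(t|x) Q_x, so that it only depends on rho_AB, and each of
   the two sums is continuous in rho by the Alicki-Fannes argument, with total
   error 8 eps log d_A + 2 h(eps). It remains to see that the quantity is <= 0
   when rho has a symmetric extension rho_ABB'. Purify the latter by G and take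
   E = B'G: by symmetry the sums become sum_x S(G|B')_x and sum_t S(G|B')_t,
   where the states of B'G are linear in the POVM element, and one concludes
   since S(G|B') is homogeneous and superadditive (strong subadditivity).
   Strong subadditivity is derived from the joint convexity of the relative
   entropy D(A||B): on the segment m = (1-s) q + s p the function
   sum_ij |<u_i|w_j>|^2 (p_i ln m_ij - m_ij) has slope (1-s) times the supremum
   over X of 2 Re tr X^*(A-B) - (1-s) tr X^* B X - s tr X A X^*, a supremum of
   linear functions of (A, B), and its increment from s = 0 to s = 1 is
   D(A||B) - tr A + tr B. *)
Require Import Defs.
From mathcomp Require Import all_boot all_order all_algebra.
From mathcomp Require Import mxtens complex.
From mathcomp Require Import all_classical all_reals all_analysis.
From mathcomp Require Import ring lra.

Set Implicit Arguments.
Unset Strict Implicit.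
Unset Printing Implicit Defensive.

Import Order.TTheory GRing.Theory Num.Theory numFieldNormedType.Exports.

Local Open Scope classical_set_scope.
Local Open Scope complex_scope.
Local Open Scope sesquilinear_scope.
Local Open Scope ring_scope.

(** * Adjoints and functional calculus of hermitian matrices *)

Section Adjoint.
Context {R : realType}.
Local Notation C := (R[i]).
Implicit Types m n p : nat.

(* Locked: otherwise unification keeps unfolding the conjugation of [R[i]]. *)
Fact adj_key : unit. Proof. exact: tt. Qed.
Definition adj m n : 'M[C]_(m, n) -> 'M[C]_(n, m) :=
  locked_with adj_key (fun A => A ^t*).

Lemma adjE m n (A : 'M[C]_(m, n)) : adj A = A ^t*.
Proof. by rewrite /adj unlock. Qed.

Lemma adj_mxE m n (A : 'M[C]_(m, n)) i j : adj A i j = (A j i)^*%R.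
Proof. by rewrite adjE !mxE. Qed.

Lemma adjK m n (A : 'M[C]_(m, n)) : adj (adj A) = A.
Proof. by rewrite !adjE trmxCK. Qed.

Lemma adjM m n p (A : 'M[C]_(m, n)) (B : 'M[C]_(n, p)) :
  adj (A *m B) = adj B *m adj A.
Proof. by rewrite !adjE trmx_mul map_mxM. Qed.

Lemma adjD m n (A B : 'M[C]_(m, n)) : adj (A + B) = adj A + adj B.
Proof. by apply/matrixP => i j; rewrite !(adj_mxE, mxE) rmorphD. Qed.

Lemma adjB m n (A B : 'M[C]_(m, n)) : adj (A - B) = adj A - adj B.
Proof. by apply/matrixP => i j; rewrite !(adj_mxE, mxE) rmorphB. Qed.

Lemma adj0 m n : adj (0 : 'M[C]_(m, n)) = 0.
Proof. by apply/matrixP => i j; rewrite !(adj_mxE, mxE) rmorph0. Qed.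

Lemma adj_sum m n (I : finType) (F : I -> 'M[C]_(m, n)) :
  adj (\sum_i F i) = \sum_i adj (F i).
Proof. by elim/big_rec2: _ => [|i A B _ <-]; rewrite ?adj0 ?adjD. Qed.

Lemma conjC_real (x : R) : (x%:C)^*%R = x%:C.
Proof. by apply/CrealP; apply/complex_realP; exists x. Qed.

Definition rtr n (A : 'M[C]_n) : R := complex.Re (\tr A).

Lemma ReD (x y : C) : complex.Re (x + y) = complex.Re x + complex.Re y.
Proof. by case: x y => [a b] [c d]. Qed.

Lemma ReN (x : C) : complex.Re (- x) = - complex.Re x.
Proof. by case: x. Qed.

Lemma ReM (a : R) (x : C) : complex.Re (a%:C * x) = a * complex.Re x.
Proof. by case: x => [b c]; rewrite /= mul0r subr0. Qed.

Lemma Re_sum (I : finType) (F : I -> C) :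
  complex.Re (\sum_i F i) = \sum_i complex.Re (F i).
Proof. by elim/big_rec2: _ => [//|i x y _ <-]; rewrite ReD. Qed.

Lemma rtr0 n : rtr (0 : 'M[C]_n) = 0.
Proof. by rewrite /rtr mxtrace0. Qed.

Lemma rtrD n (A B : 'M[C]_n) : rtr (A + B) = rtr A + rtr B.
Proof. by rewrite /rtr mxtraceD ReD. Qed.

Lemma rtrN n (A : 'M[C]_n) : rtr (- A) = - rtr A.
Proof. by rewrite /rtr raddfN ReN. Qed.

Lemma rtrB n (A B : 'M[C]_n) : rtr (A - B) = rtr A - rtr B.
Proof. by rewrite rtrD rtrN. Qed.

Lemma rtrZ n (a : R) (A : 'M[C]_n) : rtr (a%:C *: A) = a * rtr A.
Proof. by rewrite /rtr mxtraceZ ReM. Qed.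

Lemma rtr_sum n (I : finType) (F : I -> 'M[C]_n) :
  rtr (\sum_i F i) = \sum_i rtr (F i).
Proof. by rewrite /rtr (raddf_sum (@mxtrace C n)) Re_sum. Qed.

Lemma rtr_mulC m n (A : 'M[C]_(m, n)) (B : 'M[C]_(n, m)) :
  rtr (A *m B) = rtr (B *m A).
Proof. by rewrite /rtr mxtrace_mulC. Qed.

Lemma rtr1 n : rtr (1%:M : 'M[C]_n) = n%:R.
Proof.
rewrite /rtr mxtrace1 -[n%:R in LHS]/((n%:R : R[i])).
by rewrite -(rmorph_nat (real_complex R)).
Qed.

Definition unitary n (U : 'M[C]_n) : Prop :=
  U *m adj U = 1%:M /\ adj U *m U = 1%:M.

Lemma unitaryP n (U : 'M[C]_n) : U *m adj U = 1%:M -> unitary U.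
Proof. by move=> h; split=> //; apply: mulmx1C. Qed.

Lemma spectral_unitary n (A : 'M[C]_n) : unitary (spectralmx A).
Proof.
by apply: unitaryP; rewrite adjE; apply/unitarymxP/spectral_unitarymx.
Qed.

Definition rdiag n (d : 'I_n -> R) : 'M[C]_n := diag_mx (\row_i (d i)%:C).

Lemma mul_rdiag_mx m n (d : 'I_m -> R) (A : 'M[C]_(m, n)) i j :
  (rdiag d *m A) i j = (d i)%:C * A i j.
Proof. by rewrite mul_diag_mx !mxE. Qed.

Lemma mul_mx_rdiag m n (A : 'M[C]_(m, n)) (d : 'I_n -> R) i j :
  (A *m rdiag d) i j = (d j)%:C * A i j.
Proof. by rewrite mul_mx_diag !mxE mulrC. Qed.

Lemma adj_rdiag n (d : 'I_n -> R) : adj (rdiag d) = rdiag d.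
Proof.
apply/matrixP => i j; rewrite adj_mxE !mxE rmorphMn /= conjC_real eq_sym.
by case: eqP => // ->.
Qed.

Lemma rdiagM n (d e : 'I_n -> R) :
  rdiag d *m rdiag e = rdiag (fun i => d i * e i).
Proof.
rewrite /rdiag mulmx_diag; congr diag_mx; apply/rowP => i.
by rewrite !mxE rmorphM.
Qed.

(* [sandwich U d] is the operator with eigenvalues [d], whose eigenvectors are
   the adjoints of the rows of [U]. *)
Definition sandwich n (U : 'M[C]_n) (d : 'I_n -> R) : 'M[C]_n :=
  adj U *m rdiag d *m U.

Definition spec n (A : 'M[C]_n) (i : 'I_n) : R :=
  complex.Re (spectral_diag A 0 i).

Definition fmx (f : R -> R) n (A : 'M[C]_n) : 'M[C]_n :=
  sandwich (spectralmx A) (fun i => f (spec A i)).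

Lemma herm_spectralE n (A : 'M[C]_n) : adj A = A ->
  A = sandwich (spectralmx A) (spec A).
Proof.
rewrite adjE => hA.
have hA' : A \is hermsymmx.
  apply/is_hermitianmxP; rewrite expr0 scale1r.
  by apply/matrixP => i j; rewrite -{1}hA !mxE.
have /orthomx_spectralP {1}-> := hermitian_normalmx hA'.
rewrite /sandwich (invmx_unitary (spectral_unitarymx A)) -adjE.
suff -> : spectral_diag A = \row_i (spec A i)%:C by [].
apply/rowP => i; rewrite mxE /spec.
have /mxOverP/(_ 0 i) := hermitian_spectral_diag_real hA'.
by move=> /RRe_real ->.
Qed.

Lemma sandwich_adj n (U : 'M[C]_n) d : adj (sandwich U d) = sandwich U d.
Proof. by rewrite /sandwich !adjM adjK mulmxA adj_rdiag. Qed.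

Lemma fmx_adj f n (A : 'M[C]_n) : adj (fmx f A) = fmx f A.
Proof. exact: sandwich_adj. Qed.

Lemma rtr_rdiag n (d : 'I_n -> R) : rtr (rdiag d) = \sum_i d i.
Proof.
by rewrite /rtr mxtrace_diag Re_sum; apply: eq_bigr => i _; rewrite mxE.
Qed.

Lemma rtr_sandwich n (U : 'M[C]_n) d :
  unitary U -> rtr (sandwich U d) = \sum_i d i.
Proof.
by move=> [Uu _]; rewrite /sandwich rtr_mulC mulmxA Uu mul1mx rtr_rdiag.
Qed.

Lemma sandwichM n (U : 'M[C]_n) d e : unitary U ->
  sandwich U d *m sandwich U e = sandwich U (fun i => d i * e i).
Proof.
move=> [Uu _]; rewrite /sandwich -rdiagM !mulmxA.
by rewrite -(mulmxA _ U (adj U)) Uu mulmx1.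
Qed.

(** In the two eigenbases the hypothesis says that d_i - e_j annihilates entry (i, j) of
    [U *m L *m adj V]: the entry is 0 or d_i = e_j, and either way f(d_i) and f(e_j) act alike on
    it. As [L] may be rectangular, this serves for similarity, for blocks and for the two Gram
    matrices of one matrix. *)
Lemma sandwich_intertwine f m n (U : 'M[C]_m) (V : 'M[C]_n) d e
    (L : 'M[C]_(m, n)) : unitary U -> unitary V ->
  sandwich U d *m L = L *m sandwich V e ->
  sandwich U (fun i => f (d i)) *m L = L *m sandwich V (fun i => f (e i)).
Proof.
move=> [Uu uU] [Vu vV] eqL.
have key (g : 'I_m -> R) (g' : 'I_n -> R) :
   (rdiag g *m (U *m L *m adj V) = (U *m L *m adj V) *m rdiag g') <->
   sandwich U g *m L = L *m sandwich V g'.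
  rewrite /sandwich; split=> [E|E].
    have := congr1 (fun X => adj U *m X *m V) E.
    rewrite !mulmxA uU mul1mx => <-.
    by rewrite -(mulmxA _ (adj V) V) vV mulmx1.
  have := congr1 (fun X => U *m X *m adj V) E.
  by rewrite !mulmxA Uu mul1mx -(mulmxA _ V (adj V)) Vu mulmx1.
move/(key d e): eqL => eqL; apply/key.
apply/matrixP => i j; have /matrixP/(_ i j) := eqL.
rewrite !mul_rdiag_mx !mul_mx_rdiag.
have [->//|nz] := eqVneq (f (d i)) (f (e j)).
move=> /eqP; rewrite -subr_eq0 -mulrBl mulf_eq0 => /orP[|/eqP->].
  by rewrite subr_eq0 => /eqP/complexI de; rewrite de eqxx in nz.
by rewrite !mulr0.
Qed.

Lemma fmx_intertwine f m n (A : 'M[C]_m) (B : 'M[C]_n) (L : 'M[C]_(m, n)) :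
  adj A = A -> adj B = B -> A *m L = L *m B ->
  fmx f A *m L = L *m fmx f B.
Proof.
move=> /herm_spectralE {1}-> /herm_spectralE {1}->.
by apply: sandwich_intertwine; apply: spectral_unitary.
Qed.

(** Intertwining by the identity: the functional calculus does not depend on the diagonalisation
    chosen by [spectralmx]. *)
Lemma fmx_sandwich f n (U : 'M[C]_n) d : unitary U ->
  fmx f (sandwich U d) = sandwich U (fun i => f (d i)).
Proof.
move=> Uu; set A := sandwich U d.
have hA : adj A = A by exact: sandwich_adj.
rewrite -[LHS]mulmx1 -[RHS]mul1mx.
apply: sandwich_intertwine => //; first exact: spectral_unitary.
by rewrite mulmx1 mul1mx -/A -herm_spectralE.
Qed.

Lemma fmxM f g n (A : 'M[C]_n) :
  fmx f A *m fmx g A = fmx (fun x => f x * g x) A.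
Proof. by rewrite sandwichM //; apply: spectral_unitary. Qed.

Lemma fmx_id n (A : 'M[C]_n) : adj A = A -> fmx id A = A.
Proof. by move=> hA; rewrite [RHS]herm_spectralE. Qed.

Lemma rtr_fmx f n (A : 'M[C]_n) : rtr (fmx f A) = \sum_i f (spec A i).
Proof. by rewrite rtr_sandwich //; apply: spectral_unitary. Qed.

Lemma rtr_spec n (A : 'M[C]_n) : adj A = A -> rtr A = \sum_i spec A i.
Proof. by move=> hA; rewrite -{1}(fmx_id hA) rtr_fmx. Qed.

Lemma sandwich_eq n (U : 'M[C]_n) (f g : 'I_n -> R) :
  f =1 g -> sandwich U f = sandwich U g.
Proof. by move=> /funext ->. Qed.

End Adjoint.

(** * Positive semidefinite matrices and entropy *)

Section Positive.
Context {R : realType}.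
Local Notation C := (R[i]).
Implicit Types m n p : nat.

Lemma psdP n (A : 'M[C]_n) :
  psdmx A <-> forall v : 'cV[C]_n, 0 <= (adj v *m A *m v) 0 0.
Proof. by split=> h v; move: (h v); rewrite adjE. Qed.

Lemma ImD (x y : C) : complex.Im (x + y) = complex.Im x + complex.Im y.
Proof. by case: x y => [a b] [c d]. Qed.

Lemma adj_delta m n i j : adj (delta_mx i j : 'M[C]_(m, n)) = delta_mx j i.
Proof. by apply/matrixP => k l; rewrite adj_mxE !mxE rmorph_nat andbC. Qed.

Lemma psd_herm n (A : 'M[C]_n) : psdmx A -> adj A = A.
Proof.
move=> /psdP hA.
have B i j : (adj (delta_mx i 0) *m A *m delta_mx j 0 : 'M[C]_1) 0 0 = A i j.
  by rewrite adj_delta -rowE -colE !mxE.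
(* Polarisation: the form is real at e_i + c e_j, whose cross terms are these. The values 1 and i of
   c then determine A_ij from A_ji. *)
have im i j (c : C) :
    complex.Im (c * A i j + c^*%R * A j i) = 0.
  have Q v := ger0_Im (hA v).
  have addE (X Y : 'M[C]_1) : (X + Y) 0 0 = X 0 0 + Y 0 0 by rewrite mxE.
  have scaE a (X : 'M[C]_1) : (a *: X) 0 0 = a * X 0 0 by rewrite mxE.
  have := Q (delta_mx i 0 + c *: delta_mx j 0).
  rewrite adjD.
  have -> : adj (c *: delta_mx j 0 : 'cV[C]_n) = c^*%R *: adj (delta_mx j 0).
    by apply/matrixP => k l; rewrite !(adj_mxE, mxE) rmorphM.
  rewrite !(mulmxDl, mulmxDr) -!(scalemxAl, scalemxAr) !(addE, scaE) !B.
  rewrite !ImD.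
  have Ai k : complex.Im (A k k) = 0 by rewrite -B; exact: Q.
  have -> : complex.Im (c^*%R * (c * A j j)) = 0.
    case: (A j j) (Ai j) => a b /= ->; case: c => x y /=.
    by ring.
  by rewrite Ai add0r addr0 addrC.
apply/matrixP => i j; rewrite adj_mxE.
have := im i j 1; have := im i j 'i%C.
case: (A i j) => a b; case: (A j i) => c d.
rewrite /= => h1 h2; apply/eqP; rewrite eq_complex /=.
by apply/andP; split; apply/eqP; lra.
Qed.

Lemma psd_congr m n (L : 'M[C]_(m, n)) (A : 'M[C]_n) :
  psdmx A -> psdmx (L *m A *m adj L).
Proof.
move=> /psdP hA; apply/psdP => v.
by have := hA (adj L *m v); rewrite adjM adjK !mulmxA.
Qed.

Lemma psdD n (A B : 'M[C]_n) : psdmx A -> psdmx B -> psdmx (A + B).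
Proof.
by move=> hA hB v; rewrite mulmxDr mulmxDl mxE addr_ge0.
Qed.

Lemma psd0 n : psdmx (0 : 'M[C]_n).
Proof. by move=> v; rewrite mulmx0 mul0mx mxE. Qed.

Lemma psd_sum n (I : finType) (F : I -> 'M[C]_n) :
  (forall i, psdmx (F i)) -> psdmx (\sum_i F i).
Proof. by move=> h; elim/big_rec: _ => [|i A _]; [exact: psd0|exact: psdD]. Qed.

Lemma psdZ n (a : R) (A : 'M[C]_n) : 0 <= a -> psdmx A -> psdmx (a%:C *: A).
Proof.
move=> a0 hA v; rewrite -scalemxAr -scalemxAl mxE mulr_ge0 //.
by rewrite ler0c.
Qed.

Lemma psd1 n : psdmx (1%:M : 'M[C]_n).
Proof.
apply/psdP => v; rewrite mulmx1 !mxE sumr_ge0 // => i _.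
by rewrite adj_mxE mulrC mul_conjC_ge0.
Qed.

Lemma psd_gram m n (L : 'M[C]_(m, n)) : psdmx (L *m adj L).
Proof. by have := psd_congr L (@psd1 n); rewrite mulmx1. Qed.

Lemma psd_diag_ge0 n (A : 'M[C]_n) i : psdmx A -> 0 <= complex.Re (A i i).
Proof.
move=> /psdP/(_ (delta_mx i 0)).
by rewrite adj_delta -rowE -colE !mxE lecE => /andP[].
Qed.

Lemma spec_ge0 n (A : 'M[C]_n) i : psdmx A -> 0 <= spec A i.
Proof.
move=> hA; have [Uu _] := spectral_unitary A.
have := psd_diag_ge0 i (psd_congr (spectralmx A) hA).
rewrite {2}(herm_spectralE (psd_herm hA)) /sandwich !mulmxA Uu mul1mx -mulmxA Uu.
by rewrite mulmx1 !mxE eqxx mulr1n.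
Qed.

Lemma sandwich_psd n (U : 'M[C]_n) d : (forall i, 0 <= d i) ->
  psdmx (sandwich U d).
Proof.
move=> d0; suff -> : sandwich U d =
    (adj U *m rdiag (fun i => Num.sqrt (d i))) *m
    adj (adj U *m rdiag (fun i => Num.sqrt (d i))) by exact: psd_gram.
rewrite adjM adjK adj_rdiag !mulmxA -(mulmxA (adj U)) rdiagM /sandwich.
by do 2!congr (_ *m _); congr rdiag; apply/funext => i; rewrite -expr2 sqr_sqrtr.
Qed.

Definition sqrtmx n (A : 'M[C]_n) : 'M[C]_n := fmx Num.sqrt A.

Lemma sqrtmxK n (A : 'M[C]_n) : psdmx A -> sqrtmx A *m sqrtmx A = A.
Proof.
move=> hA; rewrite fmxM -[RHS](fmx_id (psd_herm hA)).
by apply: sandwich_eq => i; rewrite -expr2 sqr_sqrtr // spec_ge0.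
Qed.

Lemma adj_sqrtmx n (A : 'M[C]_n) : adj (sqrtmx A) = sqrtmx A.
Proof. exact: fmx_adj. Qed.

End Positive.

(** * Entropy in nats: invariance, block decomposition and scaling *)

Section Entropy.
Context {R : realType}.
Local Notation C := (R[i]).
Implicit Types m n p : nat.

Definition xln (x : R) : R := - (x * ln x).

Definition ent n (A : 'M[C]_n) : R := \sum_i xln (spec A i).

Lemma etaE (x : R) : eta x = xln x / ln 2.
Proof.
rewrite /eta /xln; case: eqP => [->|_]; first by rewrite !mul0r oppr0 mul0r.
by rewrite /log2 mulNr mulrA.
Qed.

Lemma vN_entropyE n (A : 'M[C]_n) : vN_entropy A = ent A / ln 2.
Proof.
by rewrite /vN_entropy /ent mulr_suml; apply: eq_bigr => i _; rewrite etaE.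
Qed.

Lemma entE n (A : 'M[C]_n) : adj A = A -> ent A = - rtr (A *m fmx (@ln R) A).
Proof.
move=> hA; rewrite -{2}(fmx_id hA) fmxM rtr_fmx -sumrN; exact: eq_bigr.
Qed.

Lemma ent_fmx n (A : 'M[C]_n) : ent A = rtr (fmx xln A).
Proof. by rewrite rtr_fmx. Qed.

Lemma ent_sandwich n (U : 'M[C]_n) d : unitary U ->
  ent (sandwich U d) = \sum_i xln (d i).
Proof. by move=> Uu; rewrite ent_fmx fmx_sandwich // rtr_sandwich. Qed.

(** [M] intertwines the two Gram matrices, hence their logarithms, and the trace is cyclic. For a
    bipartite vector reshaped as [M] this equates, up to a transposition, the entropies of the two
    marginals of a pure state. *)
Lemma ent_mulC m n (M : 'M[C]_(m, n)) : ent (M *m adj M) = ent (adj M *m M).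
Proof.
have h1 : adj (M *m adj M) = M *m adj M by rewrite adjM adjK.
have h2 : adj (adj M *m M) = adj M *m M by rewrite adjM adjK.
have hML : (M *m adj M) *m M = M *m (adj M *m M) by rewrite mulmxA.
rewrite !entE // -mulmxA rtr_mulC -mulmxA (fmx_intertwine _ h1 h2 hML).
by rewrite mulmxA.
Qed.

Lemma ent_tr n (A : 'M[C]_n) : adj A = A -> ent A^T = ent A.
Proof.
move=> /herm_spectralE; set U := spectralmx A; set d := spec A => ->.
have Uu : unitary U := spectral_unitary A.
have trU : unitary (adj U)^T.
  apply: unitaryP; have -> : adj (adj U)^T = U^T.
    by apply/matrixP => i j; rewrite !(adj_mxE, mxE) conjCK.
  by rewrite -trmx_mul; case: Uu => -> _; rewrite trmx1.
suff -> : (sandwich U d)^T = sandwich (adj U)^T d by rewrite !ent_sandwich.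
rewrite /sandwich !trmx_mul tr_diag_mx mulmxA; congr (_ *m _ *m _).
by apply/matrixP => i j; rewrite !(adj_mxE, mxE) conjCK.
Qed.

(** The [adj (L k)] are isometries whose ranges split the space, and [A] acts as [B k] on the k-th
    range, so the trace of [fmx xln A] can be taken range by range. *)
Lemma ent_blocks n p (K : finType) (L : K -> 'M[C]_(p, n)) (A : 'M[C]_n)
    (B : K -> 'M[C]_p) :
  adj A = A -> (forall k, adj (B k) = B k) ->
  (forall k, L k *m adj (L k) = 1%:M) -> \sum_k adj (L k) *m L k = 1%:M ->
  (forall k, A *m adj (L k) = adj (L k) *m B k) ->
  ent A = \sum_k ent (B k).
Proof.
move=> hA hB L1 L2 AB; rewrite ent_fmx -[fmx _ _]mulmx1 -L2 mulmx_sumr rtr_sum.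
apply: eq_bigr => k _; rewrite mulmxA (fmx_intertwine _ hA (hB k) (AB k)).
by rewrite rtr_mulC mulmxA L1 mul1mx ent_fmx.
Qed.

Lemma xlnM (a x : R) : 0 <= a -> 0 <= x -> xln (a * x) = a * xln x + xln a * x.
Proof.
rewrite /xln !le_eqVlt => /predU1P[<-|a0]; first by rewrite !(mul0r, oppr0, addr0).
move=> /predU1P[<-|x0]; first by rewrite !(mul0r, mulr0, oppr0, addr0).
by rewrite lnM ?posrE //; ring.
Qed.

Lemma ent_scale n (a : R) (A : 'M[C]_n) : 0 <= a -> psdmx A ->
  ent (a%:C *: A) = a * ent A + xln a * rtr A.
Proof.
move=> a0 hA; have hA' := psd_herm hA.
have -> : a%:C *: A = sandwich (spectralmx A) (fun i => a * spec A i).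
  rewrite {1}(herm_spectralE hA') /sandwich scalemxAl scalemxAr.
  congr (_ *m _ *m _); apply/matrixP => i j; rewrite !mxE rmorphM /=.
  by rewrite mulrnAr.
rewrite ent_sandwich; last exact: spectral_unitary.
rewrite rtr_spec // !mulr_sumr -big_split; apply: eq_bigr => i _ /=.
by rewrite xlnM // spec_ge0.
Qed.

Lemma ent_shift n (a : R) (A : 'M[C]_n) : adj A = A ->
  ent (A + a%:C%:M) = \sum_i xln (spec A i + a).
Proof.
move=> hA; have [U1 U2] := spectral_unitary A.
have -> : A + a%:C%:M = sandwich (spectralmx A) (fun i => spec A i + a).
  have -> : a%:C%:M = sandwich (spectralmx A) (fun=> a).
    rewrite /sandwich; have -> : rdiag (fun=> a) = a%:C%:M :> 'M[C]_n.
      by apply/matrixP => i j; rewrite !mxE.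
    by rewrite mul_mx_scalar -scalemxAl U2 scalemx1.
  rewrite {1}(herm_spectralE hA) /sandwich -mulmxDl -mulmxDr.
  congr (_ *m _ *m _); apply/matrixP => i j.
  by rewrite !mxE rmorphD /= mulrnDl.
by rewrite ent_sandwich //; apply: spectral_unitary.
Qed.

End Entropy.

(** * Joint convexity of the relative entropy *)

Section RelativeEntropy.
Context {R : realType}.
Local Notation C := (R[i]).
Implicit Types m n p : nat.

Definition sqnorm (z : C) : R := complex.Re z ^+ 2 + complex.Im z ^+ 2.

Lemma sqnorm_ge0 z : 0 <= sqnorm z.
Proof. by rewrite addr_ge0 // sqr_ge0. Qed.

(** Entry (j, i) is the inner product of the j-th eigenvector of [B] with the i-th one of [A]. *)
Definition overlap n (A B : 'M[C]_n) : 'M[C]_n :=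
  spectralmx B *m adj (spectralmx A).

Definition relent n (A B : 'M[C]_n) : R :=
  rtr (A *m fmx (@ln R) A) - rtr (A *m fmx (@ln R) B).

Lemma rtr_dot m n (Z Y : 'M[C]_(m, n)) :
  rtr (adj Z *m Y) = \sum_j \sum_i complex.Re ((Z j i)^*%R * Y j i).
Proof.
rewrite /rtr /mxtrace Re_sum exchange_big; apply: eq_bigr => i _ /=.
by rewrite mxE Re_sum; apply: eq_bigr => j _; rewrite adj_mxE.
Qed.

Lemma rtr_fmx2 f g n (A B : 'M[C]_n) :
  rtr (fmx f A *m fmx g B) =
  \sum_j \sum_i sqnorm (overlap A B j i) * (f (spec A i) * g (spec B j)).
Proof.
rewrite /fmx /sandwich; set P := rdiag _; set Q := rdiag _.
set U := spectralmx A; set V := spectralmx B.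
have -> : rtr (adj U *m P *m U *m (adj V *m Q *m V)) =
  rtr (adj (overlap A B) *m (Q *m (overlap A B *m P))).
  rewrite /overlap -/U -/V adjM adjK !mulmxA [RHS]rtr_mulC.
  by rewrite -!mulmxA [LHS]rtr_mulC !mulmxA.
rewrite rtr_dot; apply: eq_bigr => j _; apply: eq_bigr => i _.
rewrite mul_rdiag_mx mul_mx_rdiag.
by case: (overlap A B j i) => a b; rewrite /sqnorm /=; ring.
Qed.

(** Inserting the identity as a function of [B] brings a trace in [A] alone into the double sum used
    for mixed traces, so that comparisons can be made term by term. *)
Lemma rtr_fmx_l f n (A B : 'M[C]_n) :
  rtr (fmx f A) = \sum_j \sum_i sqnorm (overlap A B j i) * f (spec A i).
Proof.
have E : fmx (fun=> 1) B = 1%:M.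
  rewrite /fmx /sandwich (_ : rdiag _ = 1%:M).
    by rewrite mulmx1 (spectral_unitary B).2.
  by apply/matrixP => i j; rewrite !mxE.
rewrite -[fmx f A]mulmx1 -E rtr_fmx2.
by do 2![apply: eq_bigr => ? _]; rewrite mulr1.
Qed.

Lemma rtr_fmx_r f n (A B : 'M[C]_n) :
  rtr (fmx f B) = \sum_j \sum_i sqnorm (overlap A B j i) * f (spec B j).
Proof.
have E : fmx (fun=> 1) A = 1%:M.
  rewrite /fmx /sandwich (_ : rdiag _ = 1%:M).
    by rewrite mulmx1 (spectral_unitary A).2.
  by apply/matrixP => i j; rewrite !mxE.
rewrite -[fmx f B]mul1mx -E rtr_fmx2.
by do 2![apply: eq_bigr => ? _]; rewrite mul1r.
Qed.

Lemma relentE n (A B : 'M[C]_n) : adj A = A ->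
  relent A B = \sum_j \sum_i sqnorm (overlap A B j i) *
    (spec A i * (ln (spec A i) - ln (spec B j))).
Proof.
move=> hA; rewrite /relent -{1 3}(fmx_id hA) fmxM (rtr_fmx_l _ _ B) rtr_fmx2.
rewrite -sumrB; apply: eq_bigr => j _; rewrite -sumrB; apply: eq_bigr => i _.
by ring.
Qed.

Definition mix (s q p : R) : R := q + s * (p - q).

(* [relent_slope] below is the supremum of this functional over [X]; being
   linear in [(A, B)] it makes the slope jointly convex. *)
Definition relent_form n (s : R) (A B X : 'M[C]_n) : R :=
  2 * rtr (adj X *m (A - B)) - (1 - s) * rtr (adj X *m B *m X)
  - s * rtr (X *m A *m adj X).

(** In the trace inner product this is <A - B, M^-1 (A - B)> with M X = (1 - s) B X + s X A:
    rank-one matrices built from an eigenvector of [B] and one of [A] diagonalise M, with the values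
    of [mix] as eigenvalues. *)
Definition relent_slope n (s : R) (A B : 'M[C]_n) : R :=
  \sum_j \sum_i sqnorm (overlap A B j i) *
    ((spec A i - spec B j) ^+ 2 / mix s (spec B j) (spec A i)).

Lemma relent_formD n s (A1 B1 A2 B2 X : 'M[C]_n) :
  relent_form s (A1 + A2) (B1 + B2) X =
  relent_form s A1 B1 X + relent_form s A2 B2 X.
Proof.
rewrite /relent_form opprD addrACA mulmxDr (mulmxDr _ B1) mulmxDl.
rewrite (mulmxDr X) mulmxDl !rtrD.
by do 6!move: (rtr _) => ?; ring.
Qed.

Lemma relent_form_sandwich n s (U V Z : 'M[C]_n) (p q : 'I_n -> R) :
  unitary U -> unitary V ->
  relent_form s (sandwich U p) (sandwich V q) (adj V *m Z *m U) =
  \sum_j \sum_i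
    (2 * (p i - q j) * complex.Re ((Z j i)^*%R * (V *m adj U) j i)
     - mix s (q j) (p i) * sqnorm (Z j i)).
Proof.
move=> [UU _] [VV _]; rewrite /relent_form /sandwich.
have PE (X : 'M[C]_n) i j : (X *m rdiag p) i j = (p j)%:C * X i j.
  exact: mul_mx_rdiag.
have QE (X : 'M[C]_n) i j : (rdiag q *m X) i j = (q i)%:C * X i j.
  exact: mul_rdiag_mx.
move: (rdiag p) (rdiag q) PE QE => P Q PE QE.
have -> : adj (adj V *m Z *m U) = adj U *m adj Z *m V.
  by rewrite !adjM adjK mulmxA.
have VK X : X *m V *m adj V = X by rewrite -mulmxA VV mulmx1.
have UK X : X *m U *m adj U = X by rewrite -mulmxA UU mulmx1.
have E1 : rtr (adj U *m adj Z *m V *m (adj U *m P *m U)) =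
          rtr (adj Z *m ((V *m adj U) *m P)).
  by rewrite -!mulmxA rtr_mulC !mulmxA UK.
have E2 : rtr (adj U *m adj Z *m V *m (adj V *m Q *m V)) =
          rtr (adj Z *m (Q *m (V *m adj U))).
  by rewrite !mulmxA VK -!mulmxA rtr_mulC !mulmxA.
have E3 : rtr (adj U *m adj Z *m V *m (adj V *m Q *m V) *m (adj V *m Z *m U)) =
          rtr (adj Z *m (Q *m Z)).
  by rewrite !mulmxA !VK -!mulmxA rtr_mulC !mulmxA UK.
have E4 : rtr (adj V *m Z *m U *m (adj U *m P *m U) *m (adj U *m adj Z *m V)) =
          rtr (adj Z *m (Z *m P)).
  by rewrite !mulmxA !UK -!mulmxA rtr_mulC !mulmxA VK rtr_mulC mulmxA.
rewrite mulmxBr rtrB E1 E2 E3 E4 !rtr_dot -sumrB !mulr_sumr -!sumrB.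
apply: eq_bigr => j _; rewrite -sumrB !mulr_sumr -!sumrB; apply: eq_bigr => i _.
rewrite !QE !PE.
case: ((V *m adj U) j i) => a b; case: (Z j i) => c d.
by rewrite /sqnorm /mix /=; ring.
Qed.

Lemma relent_form_sum n s (A B Z : 'M[C]_n) : adj A = A -> adj B = B ->
  relent_form s A B (adj (spectralmx B) *m Z *m spectralmx A) =
  \sum_j \sum_i
    (2 * (spec A i - spec B j) * complex.Re ((Z j i)^*%R * overlap A B j i)
     - mix s (spec B j) (spec A i) * sqnorm (Z j i)).
Proof.
move=> /herm_spectralE hA /herm_spectralE hB.
have := relent_form_sandwich s Z (spec A) (spec B) (spectral_unitary A)
  (spectral_unitary B).
by rewrite -hA -hB.
Qed.

(** In the eigenbases the form decouples into one concave quadratic per complex entry of [X], and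
    completing the square bounds each of them. *)
Lemma relent_form_le n s (A B X : 'M[C]_n) : adj A = A -> adj B = B ->
  (forall i j, 0 < mix s (spec B j) (spec A i)) ->
  relent_form s A B X <= relent_slope s A B.
Proof.
move=> hA hB m0.
have [_ UU] := spectral_unitary A; have [_ VV] := spectral_unitary B.
have -> : X = adj (spectralmx B) *m
     (spectralmx B *m X *m adj (spectralmx A)) *m spectralmx A.
  by rewrite !mulmxA VV mul1mx -mulmxA UU mulmx1.
rewrite relent_form_sum //; apply: ler_sum => j _; apply: ler_sum => i _.
have := m0 i j; set mm := mix _ _ _ => mm0.
set e := spec A i - spec B j; rewrite mulrA ler_pdivlMr //.
case: (overlap A B j i) => a b; case: (_ j i) => c d.
rewrite /sqnorm /= mulNr opprK.
have := addr_ge0 (sqr_ge0 (mm * c - e * a)) (sqr_ge0 (mm * d - e * b)).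
by nra.
Qed.

(** The witness is the stationary point of each decoupled quadratic. *)
Lemma relent_form_max n s (A B : 'M[C]_n) : adj A = A -> adj B = B ->
  (forall i j, 0 < mix s (spec B j) (spec A i)) ->
  exists X, relent_form s A B X = relent_slope s A B.
Proof.
move=> hA hB m0; eexists (adj (spectralmx B) *m (\matrix_(j, i)
  (((spec A i - spec B j) / mix s (spec B j) (spec A i))%:C * overlap A B j i))
   *m spectralmx A).
rewrite relent_form_sum //; apply: eq_bigr => j _; apply: eq_bigr => i _.
rewrite mxE; have := m0 i j; set mm := mix _ _ _ => mm0.
case: (overlap A B j i) => a b; rewrite /sqnorm /=.
by field; rewrite gt_eqF.
Qed.

(** A supremum of linear functionals is subadditive: a maximiser for the sum is tested on both
    summands. *)
Lemma relent_slopeD n s (A1 B1 A2 B2 : 'M[C]_n) :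
  adj A1 = A1 -> adj B1 = B1 -> adj A2 = A2 -> adj B2 = B2 ->
  (forall i j, 0 < mix s (spec B1 j) (spec A1 i)) ->
  (forall i j, 0 < mix s (spec B2 j) (spec A2 i)) ->
  (forall i j, 0 < mix s (spec (B1 + B2) j) (spec (A1 + A2) i)) ->
  relent_slope s (A1 + A2) (B1 + B2) <=
  relent_slope s A1 B1 + relent_slope s A2 B2.
Proof.
move=> hA1 hB1 hA2 hB2 h1 h2 h3.
have [||X <-] := relent_form_max _ _ h3; rewrite ?adjD ?hA1 ?hA2 ?hB1 ?hB2 //.
by rewrite relent_formD lerD // relent_form_le.
Qed.

End RelativeEntropy.

(** * From the slope to the relative entropy *)

Section JointConvexity.
Context {R : realType}.
Local Notation C := (R[i]).
Implicit Types m n p : nat.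

Definition relent_path n (A B : 'M[C]_n) (s : R) : R :=
  \sum_j \sum_i sqnorm (overlap A B j i) *
    (spec A i * ln (mix s (spec B j) (spec A i)) - mix s (spec B j) (spec A i)).

Lemma mix_gt0 (s q p : R) : 0 < q -> 0 < p -> 0 <= s <= 1 -> 0 < mix s q p.
Proof. by rewrite /mix => ? ? /andP[? ?]; nra. Qed.

(** Writing m for the mixed value, the derivative is w (p - q)(p - m) / m, and p - m = (1 - s)(p -
    q). *)
Lemma is_derive_path_term (w q p s : R) : 0 < q -> 0 < p -> 0 <= s <= 1 ->
  is_derive s 1 (fun s => w * (p * ln (mix s q p) - mix s q p))
    ((1 - s) * (w * ((p - q) ^+ 2 / mix s q p))).
Proof.
move=> hq hp hs; have m0 := mix_gt0 hq hp hs.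
have dm : is_derive s 1 (fun s => mix s q p) (p - q).
  have -> : (fun s => mix s q p) = cst q + (p - q) \*: id.
    by apply/funext => t; rewrite /mix mulrC.
  by apply: is_derive_eq; rewrite add0r /GRing.scale /= mulr1.
have dl : is_derive s 1 (fun s => ln (mix s q p)) ((p - q) / mix s q p).
  have := @is_derive1_comp _ (@ln R) (fun s => mix s q p) s _ _
    (is_derive1_ln m0) dm.
  by rewrite mulrC.
have -> : (fun s => w * (p * ln (mix s q p) - mix s q p)) =
   w \*: (p \*: (fun s => ln (mix s q p)) - (fun s => mix s q p)).
  by apply/funext.
apply: is_derive_eq; rewrite /GRing.scale /= /mix in m0 *.
by field; rewrite gt_eqF.
Qed.

Lemma is_derive_relent_path n (A B : 'M[C]_n) (s : R) :
  (forall i, 0 < spec A i) -> (forall i, 0 < spec B i) -> 0 <= s <= 1 ->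
  is_derive s 1 (relent_path A B) ((1 - s) * relent_slope s A B).
Proof.
move=> hA hB hs.
have -> : relent_path A B = \sum_j \sum_i (fun s => sqnorm (overlap A B j i) *
    (spec A i * ln (mix s (spec B j) (spec A i)) - mix s (spec B j) (spec A i))).
  apply/funext => t; rewrite /relent_path fct_sumE; apply: eq_bigr => j _.
  by rewrite fct_sumE.
rewrite /relent_slope mulr_sumr; apply: is_derive_sum => j.
rewrite mulr_sumr; apply: is_derive_sum => i.
exact: is_derive_path_term.
Qed.

Lemma relent_pathE n (A B : 'M[C]_n) : adj A = A -> adj B = B ->
  relent_path A B 1 - relent_path A B 0 = relent A B - rtr A + rtr B.
Proof.
move=> hA hB; rewrite relentE //.
have -> : rtr A = rtr (fmx id A) by rewrite fmx_id.
have -> : rtr B = rtr (fmx id B) by rewrite fmx_id.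
rewrite (rtr_fmx_l _ A B) (rtr_fmx_r _ A B) -!sumrB -big_split /=.
apply: eq_bigr => j _; rewrite -!sumrB -big_split /=; apply: eq_bigr => i _.
by rewrite /mix mul1r mul0r addr0 (addrC (spec B j)) subrK; ring.
Qed.

(** Positive definiteness as a uniform gap above 0, a form that sums, partial traces and lifts
    visibly preserve. *)
Definition pdmx n (A : 'M[C]_n) : Prop :=
  exists2 a : R, 0 < a & exists2 B, psdmx B & A = B + a%:C%:M.

Lemma pd_psd n (A : 'M[C]_n) : pdmx A -> psdmx A.
Proof.
move=> [a a0 [B hB ->]]; rewrite -scalemx1.
exact: (psdD hB (psdZ (ltW a0) (@psd1 R n))).
Qed.

Lemma pdD n (A B : 'M[C]_n) : pdmx A -> pdmx B -> pdmx (A + B).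
Proof.
move=> [a a0 [A' hA ->]] [b b0 [B' hB ->]]; exists (a + b); first exact: addr_gt0.
exists (A' + B'); first exact: psdD.
by rewrite addrACA -raddfD rmorphD.
Qed.

Lemma pd_spec_gt0 n (A : 'M[C]_n) i : pdmx A -> 0 < spec A i.
Proof.
move=> pA; have hA := psd_herm (pd_psd pA); have [UU UV] := spectral_unitary A.
have E : complex.Re ((spectralmx A *m A *m adj (spectralmx A)) i i) = spec A i.
  rewrite {2}(herm_spectralE hA) /sandwich !mulmxA UU mul1mx -mulmxA UU.
  by rewrite mulmx1 !mxE eqxx mulr1n.
rewrite -E; case: pA => a a0 [B hB AE]; rewrite [X in _ *m X *m _]AE.
rewrite mulmxDr mulmxDl mxE ReD ltr_wpDl //; first exact/psd_diag_ge0/psd_congr.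
by rewrite mul_mx_scalar -scalemxAl UU !mxE eqxx mulr1.
Qed.

(** Joint convexity for unnormalised operators. The gap between the two sides is the increment of
    [H] over [0, 1], the trace corrections cancelling. By the mean value theorem it equals [dH c]
    for some c, which is 1 - c times the nonnegative gap of [relent_slopeD]. *)
Lemma relentD n (A1 B1 A2 B2 : 'M[C]_n) :
  pdmx A1 -> pdmx B1 -> pdmx A2 -> pdmx B2 ->
  relent (A1 + A2) (B1 + B2) <= relent A1 B1 + relent A2 B2.
Proof.
move=> pA1 pB1 pA2 pB2; have pA := pdD pA1 pA2; have pB := pdD pB1 pB2.
have herm (X : 'M[C]_n) : pdmx X -> adj X = X by move=> /pd_psd/psd_herm.
pose H : R -> R := relent_path A1 B1 + relent_path A2 B2 - relent_path (A1 + A2) (B1 + B2).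
pose dH (s : R) : R := (1 - s) * relent_slope s A1 B1 + (1 - s) * relent_slope s A2 B2
   - (1 - s) * relent_slope s (A1 + A2) (B1 + B2).
have dP (s : R) : 0 <= s <= 1 -> is_derive s 1 H (dH s).
  move=> hs; apply: is_deriveB; first apply: is_deriveD;
  by apply: is_derive_relent_path => // i; apply: pd_spec_gt0.
have [|s|c cI E] := @MVT_segment R H dH 0 1 ler01.
- move=> x; rewrite in_itv /= => /andP[x0 x1]; apply: dP.
  by rewrite !ltW.
- apply: derivable_within_continuous => x; rewrite in_itv /= => hx.
  by have [] := dP _ hx.
have : 0 <= dH c.
  rewrite in_itv /= in cI; rewrite /dH -mulrDr -mulrBr mulr_ge0 ?subr_ge0 //.
    by case/andP: cI.
  apply: relent_slopeD => [||||i j|i j|i j]; try exact: herm;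
  by apply: mix_gt0 => //; apply: pd_spec_gt0.
move: E; rewrite subr0 mulr1 => <-.
have := relent_pathE (herm _ pA1) (herm _ pB1).
have := relent_pathE (herm _ pA2) (herm _ pB2).
have := relent_pathE (herm _ pA) (herm _ pB).
have HE (s : R) : H s = relent_path A1 B1 s + relent_path A2 B2 s
                  - relent_path (A1 + A2) (B1 + B2) s by [].
rewrite !HE !rtrD; do 6!move: (relent_path _ _ _) => ?.
by do 4!move: (rtr _) => ?; do 3!move: (relent _ _) => ?; lra.
Qed.

End JointConvexity.

(** * Klein inequality and continuity of the entropy *)

Section EntropyLimits.
Context {R : realType}.
Local Notation C := (R[i]).
Implicit Types m n p : nat.

(** From ln y <= y at y = 1 / sqrt x. The bound tends to 0 with x and so gives continuity of [xln]
    at 0; for x <= 0 both bounds hold because [ln] takes the value 0 there. *)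
Lemma xln_le_sqrt (x : R) : x <= 1 -> 0 <= xln x <= 2 * Num.sqrt x.
Proof.
move=> x1; rewrite /xln; case: (leP x 0) => [x0|x0].
  by rewrite ln0 // mulr0 oppr0 lexx mulr_ge0 // sqrtr_ge0.
rewrite -mulrN mulr_ge0 ?(ltW x0) ?oppr_ge0 ?ln_le0 //=.
have s0 : 0 < Num.sqrt x by rewrite sqrtr_gt0.
have sx : x = Num.sqrt x ^+ 2 by rewrite sqr_sqrtr // ltW.
have iv0 : 0 < (Num.sqrt x)^-1 by rewrite invr_gt0.
have -> : - ln x = 2 * ln (Num.sqrt x)^-1.
  by rewrite lnV ?posrE // {1}sx lnXn //; ring.
have h := ltW (ln_sublinear iv0).
rewrite {1}sx; set s := Num.sqrt x in s0 h *.
have -> : 2 * s = s ^+ 2 * (2 * s^-1) by field; rewrite gt_eqF.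
by rewrite ler_pM2l ?exprn_gt0 // ler_pM2l.
Qed.

Lemma continuous_xln : continuous (@xln R).
Proof.
move=> x; case: (ltgtP x (0 : R)) => [x0|x0|->].
- have : (cst 0 : R -> R) @ x --> (0 : R) by exact: cvg_cst.
  rewrite /continuous_at {2}/xln ln0 ?(ltW x0) // mulr0 oppr0.
  apply: cvg_trans; apply: near_eq_cvg; near=> y.
  rewrite /xln ln0 ?mulr0 ?oppr0 //; apply: ltW; near: y.
  exact: lt_nbhsl.
- rewrite /continuous_at /xln; apply: cvgN; apply: cvgM; first exact: cvg_id.
  exact: continuous_ln.
- rewrite /continuous_at {2}/xln mul0r oppr0.
  apply: (@squeeze_cvgr _ _ _ _ (cst 0) (fun y => 2 * Num.sqrt y)).
  + near=> y; apply: xln_le_sqrt; apply: ltW; near: y.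
    exact: lt_nbhsl ltr01.
  + exact: cvg_cst.
  + have : 2 * Num.sqrt y @[y --> (0 : R)] --> 2 * Num.sqrt (0 : R).
      by apply: cvgMl_tmp; exact: sqrt_continuous.
    by rewrite sqrtr0 mulr0.
Unshelve. all: by end_near. Qed.

(** Inequalities are proved for positive definite operators first and reach semidefinite ones by
    letting a shift t tend to 0. The factor [k] allows for the shift 2t of a sum and for the
    dimension factor of a partial trace. *)
Lemma ent_cvg n (A : 'M[C]_n) (k : R) : adj A = A ->
  ent (A + (k * t)%:C%:M) @[t --> (0:R)^'+] --> ent A.
Proof.
move=> hA; under eq_fun do rewrite ent_shift //.
apply: cvg_big => [|i _]; first exact: add_continuous.
have : (fun t : R => xln (spec A i + k * t)) @ (0 : R) -->
       xln (spec A i + k * 0).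
  apply: (@continuous_comp _ _ _ (fun t : R => spec A i + k * t) (@xln R)).
    apply: cvgD; first exact: cvg_cst.
    by apply: cvgMl_tmp; exact: cvg_id.
  exact: continuous_xln.
rewrite mulr0 addr0; apply: cvg_trans; apply: cvg_app.
exact: cvg_within.
Qed.

Lemma psd_shift_pd n (A : 'M[C]_n) (t : R) : psdmx A -> 0 < t ->
  pdmx (A + t%:C%:M).
Proof. by move=> hA t0; exists t => //; exists A. Qed.

Lemma shiftD n (A B : 'M[C]_n) (t : R) :
  A + t%:C%:M + (B + t%:C%:M) = A + B + (2 * t)%:C%:M.
Proof.
rewrite addrACA; congr (_ + _).
by apply/matrixP => i j; rewrite !mxE -mulrnDl -rmorphD /= mulr2n mulrDl !mul1r.
Qed.

(** Term by term this is ln x <= x - 1 at x = q r / p. The free scale [r] is later a mixing weight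
    or the inverse of a dimension. *)
Lemma klein n (A B : 'M[C]_n) (r : R) : 0 < r -> pdmx A -> pdmx B ->
  rtr A * ln r + rtr A - r * rtr B <= relent A B.
Proof.
move=> r0 pA pB; have hA := psd_herm (pd_psd pA).
have hB := psd_herm (pd_psd pB).
have -> : rtr A = rtr (fmx id A) by rewrite fmx_id.
have -> : rtr B = rtr (fmx id B) by rewrite fmx_id.
rewrite relentE // (rtr_fmx_l _ A B) (rtr_fmx_r _ A B).
rewrite mulr_suml mulr_sumr -big_split -sumrB /=; apply: ler_sum => j _.
rewrite mulr_suml mulr_sumr -big_split -sumrB /=; apply: ler_sum => i _.
have := pd_spec_gt0 i pA; have := pd_spec_gt0 j pB.
move: (spec A i) (spec B j) (sqnorm_ge0 (overlap A B j i)) => p q.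
move: (sqnorm _) => w w0 q0 p0.
suff : p * ln r + p - r * q <= p * (ln p - ln q) by nra.
have x0 : 0 < q * r / p by rewrite !(mulr_gt0, invr_gt0).
have : ln (q * r / p) <= q * r / p - 1.
  have -> : ln (q * r / p) = ln (1 + (q * r / p - 1)) by congr ln; ring.
  by apply: le_ln1Dx; lra.
have -> : ln (q * r / p) = ln q + ln r - ln p.
  by rewrite ln_div ?posrE ?mulr_gt0 // lnM ?posrE.
rewrite -(ler_pM2l p0).
have -> : p * (q * r / p - 1) = q * r - p by field; rewrite gt_eqF.
by nra.
Qed.

(** Klein's inequality for [A] and for [B] against [A + B], at scales r and 1 - r, for which the
    linear terms cancel. When r is the share of [A] in the total trace, this is concavity of the
    entropy. *)
Lemma ent_subadd_traces n (A B : 'M[C]_n) (r : R) : 0 < r < 1 ->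
  psdmx A -> psdmx B ->
  ent A + ent B <= ent (A + B) - rtr A * ln r - rtr B * ln (1 - r).
Proof.
move=> /andP[r0 r1] hA hB.
have pd_case (X Y : 'M[C]_n) : pdmx X -> pdmx Y ->
  ent X + ent Y <= ent (X + Y) - rtr X * ln r - rtr Y * ln (1 - r).
  move=> pX pY; have pXY := pdD pX pY.
  have r1' : 0 < 1 - r by rewrite subr_gt0.
  have := klein r0 pX pXY; have := klein r1' pY pXY.
  rewrite !entE ?(psd_herm (pd_psd _)) // /relent {5}/fmx.
  by rewrite mulmxDl !rtrD; do 6!move: (rtr _) => ?; lra.
have hAB : adj (A + B) = A + B by apply/psd_herm/psdD.
have lim1 : ent (A + (1 * t)%:C%:M) + ent (B + (1 * t)%:C%:M) @[t --> (0:R)^'+]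
    --> ent A + ent B by apply: cvgD; apply: ent_cvg; apply: psd_herm.
have cvgt : t @[t --> (0:R)^'+] --> (0:R) by apply: cvg_within.
have lim2 : ent (A + B + (2 * t)%:C%:M) - (rtr A + t * n%:R) * ln r
    - (rtr B + t * n%:R) * ln (1 - r) @[t --> (0:R)^'+]
    --> ent (A + B) - (rtr A + 0 * n%:R) * ln r - (rtr B + 0 * n%:R) * ln (1 - r).
  by apply: cvgB; [apply: cvgB; first exact: ent_cvg|];
    apply: cvgMr_tmp; apply: cvgD; (try exact: cvg_cst); apply: cvgMr_tmp.
rewrite !mul0r !addr0 in lim2.
apply: (ler_cvg_to lim1 lim2); near=> t.
have t0 : 0 < t by near: t; exact: nbhs_right_gt.
have := pd_case _ _ (psd_shift_pd hA t0) (psd_shift_pd hB t0).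
rewrite shiftD !rtrD mul1r.
have -> : rtr (t%:C%:M : 'M[C]_n) = t * n%:R by rewrite -scalemx1 rtrZ rtr1.
by [].
Unshelve. all: by end_near. Qed.

End EntropyLimits.

(** * Strong subadditivity *)

Section ConditionalEntropy.
Context {R : realType}.
Local Notation C := (R[i]).
Implicit Types m n p d : nat.

(* [L k] stands for [<k| (x) 1], so that [C^n] is [C^d (x) C^p]. *)
Definition factor d p n (L : 'I_d -> 'M[C]_(p, n)) : Prop :=
  [/\ (0 < d)%N, forall k l, L k *m adj (L l) = (k == l)%:R%:M &
      \sum_k adj (L k) *m L k = 1%:M].

Definition ptr d p n (L : 'I_d -> 'M[C]_(p, n)) (A : 'M[C]_n) : 'M[C]_p :=
  \sum_k L k *m A *m adj (L k).

(** This is 1 (x) X, the adjoint of [ptr] for the trace pairing. *)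
Definition lift_op d p n (L : 'I_d -> 'M[C]_(p, n)) (X : 'M[C]_p) : 'M[C]_n :=
  \sum_k adj (L k) *m X *m L k.

(* [condent L] is the conditional entropy S(A|B) for A = C^d, B = C^p. *)
Definition condent d p n (L : 'I_d -> 'M[C]_(p, n)) (A : 'M[C]_n) : R :=
  ent A - ent (ptr L A).

Section Factor.
Context d p n (L : 'I_d -> 'M[C]_(p, n)) (fL : factor L).

Let d_gt0 : (0 < d)%N. Proof. by case: fL. Qed.
Let LL k l : L k *m adj (L l) = (k == l)%:R%:M. Proof. by case: fL. Qed.
Let sumLL : \sum_k adj (L k) *m L k = 1%:M. Proof. by case: fL. Qed.

Lemma ptr_psd A : psdmx A -> psdmx (ptr L A).
Proof. by move=> hA; apply: psd_sum => k; apply: psd_congr. Qed.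

Lemma ptrD A B : ptr L (A + B) = ptr L A + ptr L B.
Proof.
by rewrite -big_split; apply: eq_bigr => k _; rewrite mulmxDr mulmxDl.
Qed.

Lemma ptr0 : ptr L 0 = 0.
Proof. by rewrite /ptr big1 // => k _; rewrite mulmx0 mul0mx. Qed.

Lemma ptrZ (a : C) A : ptr L (a *: A) = a *: ptr L A.
Proof.
rewrite /ptr scaler_sumr; apply: eq_bigr => k _.
by rewrite -scalemxAr -scalemxAl.
Qed.

Lemma ptr_scalar (a : R) : ptr L a%:C%:M = (d%:R * a)%:C%:M.
Proof.
rewrite /ptr (eq_bigr (fun=> a%:C%:M)) => [|k _].
  by rewrite sumr_const card_ord -raddfMn /= -rmorphMn mulr_natl.
by rewrite mul_mx_scalar -scalemxAl LL eqxx scalemx1.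
Qed.

Lemma rtr_lift A X : rtr (A *m lift_op L X) = rtr (ptr L A *m X).
Proof.
rewrite mulmx_sumr mulmx_suml !rtr_sum; apply: eq_bigr => k _.
by rewrite !mulmxA rtr_mulC !mulmxA.
Qed.

Lemma lift_op1 : lift_op L 1%:M = 1%:M.
Proof. by rewrite -[RHS]sumLL; apply: eq_bigr => k _; rewrite mulmx1. Qed.

Lemma rtr_ptr A : rtr (ptr L A) = rtr A.
Proof. by rewrite -[ptr L A]mulmx1 -rtr_lift lift_op1 mulmx1. Qed.

Lemma rtr_lift_op X : rtr (lift_op L X) = d%:R * rtr X.
Proof.
rewrite -[lift_op L X]mul1mx rtr_lift -[1%:M]/((1 : R)%:C%:M) ptr_scalar mulr1.
by rewrite -scalemx1 -scalemxAl rtrZ mul1mx.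
Qed.

Lemma lift_op_psd X : psdmx X -> psdmx (lift_op L X).
Proof.
move=> hX; apply: psd_sum => k.
by have := psd_congr (adj (L k)) hX; rewrite adjK.
Qed.

Lemma lift_op_pd X : pdmx X -> pdmx (lift_op L X).
Proof.
move=> [a a0 [B hB ->]]; exists a => //; exists (lift_op L B).
  exact: lift_op_psd.
have <- : lift_op L a%:C%:M = a%:C%:M.
  rewrite -[in RHS]scalemx1 -lift_op1 scaler_sumr; apply: eq_bigr => k _.
  by rewrite mulmx1 mul_mx_scalar scalemxAl.
by rewrite -big_split; apply: eq_bigr => k _; rewrite mulmxDr mulmxDl.
Qed.

Lemma ptr_pd A : pdmx A -> pdmx (ptr L A).
Proof.
move=> [a a0 [B hB ->]]; exists (d%:R * a).
  by rewrite mulr_gt0 // ltr0n.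
by exists (ptr L B); [exact: ptr_psd|rewrite ptrD ptr_scalar].
Qed.

(** Each [adj (L k)] intertwines 1 (x) X with X, hence also their functions. *)
Lemma fmx_lift f X : adj X = X -> fmx f (lift_op L X) = lift_op L (fmx f X).
Proof.
move=> hX.
have hl : adj (lift_op L X) = lift_op L X.
  rewrite adj_sum; apply: eq_bigr => k _.
  by rewrite !adjM adjK hX mulmxA.
rewrite -[LHS]mulmx1 -sumLL mulmx_sumr; apply: eq_bigr => k _.
rewrite mulmxA (fmx_intertwine f hl hX) // mulmx_suml (bigD1 k) //=.
rewrite -!mulmxA LL eqxx mulmx1 big1 ?addr0 // => l lk.
by rewrite -!mulmxA LL (negPf lk) raddf0 !mulmx0.
Qed.

(** The logarithm of the lifted marginal is the lift of a logarithm, and duality moves it to the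
    marginal. Conditional entropy thereby comes within reach of joint convexity and of Klein's
    inequality. *)
Lemma condent_relent A : adj A = A ->
  relent A (lift_op L (ptr L A)) = - condent L A.
Proof.
move=> hA; have hp : adj (ptr L A) = ptr L A.
  by rewrite adj_sum; apply: eq_bigr => k _; rewrite !adjM adjK hA mulmxA.
by rewrite /relent /condent !entE // fmx_lift // rtr_lift; ring.
Qed.

Lemma condent_cvg A (k : R) : psdmx A ->
  condent L (A + (k * t)%:C%:M) @[t --> (0:R)^'+] --> condent L A.
Proof.
move=> hA; apply: cvgB; first exact/ent_cvg/psd_herm.
under eq_fun do rewrite ptrD ptr_scalar mulrA.
exact/ent_cvg/psd_herm/ptr_psd.
Qed.

(* Strong subadditivity of the von Neumann entropy. *)
Lemma condentD A B : psdmx A -> psdmx B ->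
  condent L A + condent L B <= condent L (A + B).
Proof.
move=> hA hB.
have pd_case X Y : pdmx X -> pdmx Y ->
    condent L X + condent L Y <= condent L (X + Y).
  move=> pX pY; have herm (Z : 'M[C]_n) : pdmx Z -> adj Z = Z.
    by move=> /pd_psd/psd_herm.
  (* Joint convexity for the pairs (X, 1 (x) X_B) and (Y, 1 (x) Y_B), whose second members add up by
     linearity of the marginal. *)
  have := relentD pX (lift_op_pd (ptr_pd pX)) pY (lift_op_pd (ptr_pd pY)).
  have -> : lift_op L (ptr L X) + lift_op L (ptr L Y) = lift_op L (ptr L (X + Y)).
    rewrite ptrD /lift_op -big_split; apply: eq_bigr => k _.
    by rewrite mulmxDr mulmxDl.
  rewrite !condent_relent ?herm //; last exact: pdD.
  by rewrite -opprD lerN2.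
have lim1 : condent L (A + (1 * t)%:C%:M) + condent L (B + (1 * t)%:C%:M)
    @[t --> (0:R)^'+] --> condent L A + condent L B.
  by apply: cvgD; apply: condent_cvg.
have lim2 := condent_cvg 2 (psdD hA hB).
apply: (ler_cvg_to lim1 lim2); near=> t.
have t0 : 0 < t by near: t; exact: nbhs_right_gt.
have := pd_case _ _ (psd_shift_pd hA t0) (psd_shift_pd hB t0).
by rewrite shiftD !mul1r.
Unshelve. all: by end_near. Qed.

Lemma condent0 : condent L 0 = 0.
Proof.
have e0 q : ent (0 : 'M[C]_q) = 0.
  have := @ent_scale R q 0 0 (lexx 0) (@psd0 R q).
  by rewrite scaler0 mul0r add0r rtr0 mulr0.
by rewrite /condent ptr0 !e0 subrr.
Qed.

Lemma condentZ (a : R) A : 0 <= a -> psdmx A ->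
  condent L (a%:C *: A) = a * condent L A.
Proof.
move=> a0 hA; rewrite /condent ptrZ !ent_scale // ?rtr_ptr; first by ring.
exact: ptr_psd.
Qed.

Lemma condent_sum (I : finType) (F : I -> 'M[C]_n) :
  (forall i, psdmx (F i)) -> \sum_i condent L (F i) <= condent L (\sum_i F i).
Proof.
move=> hF; suff [] : psdmx (\sum_i F i) /\
  \sum_i condent L (F i) <= condent L (\sum_i F i) by [].
elim/big_rec2: _ => [|i s A _ [hA le]]; first by rewrite condent0; split => //; exact: psd0.
split; first exact: (psdD (hF i) hA).
exact: le_trans (lerD (lexx _) le) (condentD (hF i) hA).
Qed.

(** Klein's inequality against the lifted marginal at scale 1/d: lifting multiplies the trace by d,
    so the linear terms cancel. *)
Lemma condent_le A : psdmx A -> condent L A <= rtr A * ln d%:R.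
Proof.
move=> hA; have d0 : 0 < d%:R :> R by rewrite ltr0n.
have pd_case X : pdmx X -> condent L X <= rtr X * ln d%:R.
  move=> pX; have r0 : 0 < d%:R^-1 :> R by rewrite invr_gt0.
  have := klein r0 pX (lift_op_pd (ptr_pd pX)).
  rewrite condent_relent; last exact/psd_herm/pd_psd.
  rewrite rtr_lift_op rtr_ptr mulrA mulVf ?gt_eqF // mul1r lnV ?posrE //.
  by rewrite mulrN; lra.
have lim1 := condent_cvg 1 hA.
have lim2 : (rtr A + t * n%:R) * ln d%:R @[t --> (0:R)^'+] -->
    (rtr A + 0 * n%:R) * ln d%:R.
  apply: cvgMr_tmp; apply: cvgD; first exact: cvg_cst.
  by apply: cvgMr_tmp; apply: cvg_within.
rewrite mul0r addr0 in lim2.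
apply: (ler_cvg_to lim1 lim2); near=> t.
have t0 : 0 < t by near: t; exact: nbhs_right_gt.
have := pd_case _ (psd_shift_pd hA t0).
by rewrite mul1r rtrD -scalemx1 rtrZ rtr1 scalemx1.
Unshelve. all: by end_near. Qed.

End Factor.

Lemma ent11 (A : 'M[C]_1) : adj A = A -> ent A = xln (rtr A).
Proof. by move=> hA; rewrite /ent rtr_spec // !big_ord1. Qed.

(** The bound [condent_le] with a one-dimensional conditioning system, whose entropy is [xln] of the
    trace. *)
Lemma ent_le n (A : 'M[C]_n) : (0 < n)%N -> psdmx A ->
  ent A <= rtr A * ln n%:R + xln (rtr A).
Proof.
move=> n0 hA.
have fL : factor (fun k : 'I_n => delta_mx 0 k : 'M[C]_(1, n)).
  split=> // [k l|].
    rewrite adj_delta mul_delta_mx_cond; apply/matrixP => i j.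
    by case: eqP => _; rewrite !ord1 !mxE.
  apply/matrixP => i j; rewrite summxE (bigD1 i) //= big1 ?addr0 => [|k ki].
    by rewrite adj_delta mul_delta_mx !mxE eqxx eq_sym.
  by rewrite adj_delta mul_delta_mx !mxE eq_sym (negPf ki).
have := condent_le fL hA; rewrite /condent ent11 ?rtr_ptr //; first by lra.
exact/psd_herm/ptr_psd.
Qed.

Lemma psd_decomp n (A : 'M[C]_n) : psdmx A ->
  exists v : 'I_n -> 'cV[C]_n, A = \sum_i v i *m adj (v i).
Proof.
move=> hA; exists (fun i => col i (sqrtmx A)).
rewrite -{1}(sqrtmxK hA) -{2}(adj_sqrtmx A).
apply/matrixP => i j; rewrite mxE summxE; apply: eq_bigr => k _.
by rewrite !mxE big_ord1 !(adj_mxE, mxE).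
Qed.

Lemma ent_pure n (v : 'cV[C]_n) : ent (v *m adj v) = xln (rtr (v *m adj v)).
Proof. by rewrite ent_mulC ent11 ?adjM ?adjK // rtr_mulC. Qed.

(** * Lower bounds by reduction to rank-one operators *)

Section FactorLower.
Context d p n (L : 'I_d -> 'M[C]_(p, n)) (fL : factor L).

(** Reshape [v] as a p x d matrix N. The marginal N adj N has the entropy of adj N N, which lives on
    C^d and is therefore bounded through d. *)
Lemma condent_pure_ge (v : 'cV[C]_n) :
  - (rtr (v *m adj v) * ln d%:R) <= condent L (v *m adj v).
Proof.
have [d0 _ _] := fL; rewrite /condent ent_pure.
pose N : 'M[C]_(p, d) := \matrix_(i, k) (L k *m v) i 0.
have E : ptr L (v *m adj v) = N *m adj N.
  apply/matrixP => i j; rewrite summxE [RHS]mxE; apply: eq_bigr => k _.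
  rewrite -mulmxA -mulmxA -adjM mulmxA mxE big_ord1 !adj_mxE.
  by rewrite ![N _ _]mxE.
have hN : psdmx (adj N *m N) by have := psd_gram (adj N); rewrite adjK.
have := ent_le d0 hN.
by rewrite E ent_mulC (rtr_mulC (adj N)) -E rtr_ptr //; lra.
Qed.

Lemma condent_ge A : psdmx A -> - (rtr A * ln d%:R) <= condent L A.
Proof.
move=> /psd_decomp[v ->].
apply: le_trans (condent_sum fL (fun i => psd_gram (v i))).
rewrite rtr_sum mulr_suml -sumrN; apply: ler_sum => i _.
exact: condent_pure_ge.
Qed.

(** Put the [B k] into a block-diagonal operator A, whose conditional entropy is the right side
    minus the left. A is a sum of rank-one operators, each inside a single block and so of equal
    joint and marginal entropy; superadditivity makes the conditional entropy of A nonnegative. *)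
Lemma ent_sum_le (B : 'I_d -> 'M[C]_p) : (forall k, psdmx (B k)) ->
  ent (\sum_k B k) <= \sum_k ent (B k).
Proof.
move=> hB; have [d0 LL sumLL] := fL.
pose A := \sum_k adj (L k) *m B k *m L k.
have AL k : A *m adj (L k) = adj (L k) *m B k.
  rewrite mulmx_suml (bigD1 k) //= -!mulmxA LL eqxx mulmx1.
  rewrite big1 ?addr0 // => l lk.
  by rewrite -!mulmxA LL (negPf lk) raddf0 !mulmx0.
have hA : adj A = A.
  rewrite adj_sum; apply: eq_bigr => k _.
  by rewrite !adjM adjK (psd_herm (hB k)) mulmxA.
have ptA : ptr L A = \sum_k B k.
  by apply: eq_bigr => k _; rewrite -mulmxA AL mulmxA LL eqxx mul1mx.
have entA : ent A = \sum_k ent (B k).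
  apply: (ent_blocks hA _ _ sumLL AL) => k; first exact: (psd_herm (hB k)).
  by rewrite LL eqxx.
rewrite -subr_ge0 -entA -ptA -/(condent L A).
pose v k := projT1 (cid (psd_decomp (hB k))).
have vE k : B k = \sum_i v k i *m adj (v k i).
  exact: (projT2 (cid (psd_decomp (hB k)))).
pose w (ki : 'I_d * 'I_p) := adj (L ki.1) *m v ki.1 ki.2.
have -> : A = \sum_ki w ki *m adj (w ki).
  rewrite -(pair_bigA _ (fun k i => w (k, i) *m adj (w (k, i)))) /=.
  apply: eq_bigr => k _; rewrite {1}vE mulmx_sumr mulmx_suml.
  by apply: eq_bigr => i _; rewrite /w adjM adjK !mulmxA.
apply: le_trans (condent_sum fL (fun i => psd_gram (w i))).
apply: sumr_ge0 => -[k i] _; rewrite /condent.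
suff -> : ptr L (w (k, i) *m adj (w (k, i))) = v k i *m adj (v k i).
  rewrite !ent_pure /w /= adjM adjK [in rtr (_ *m (_ *m L k))]rtr_mulC.
  by rewrite -!mulmxA (mulmxA (L k)) LL eqxx mul1mx rtr_mulC subrr.
rewrite /ptr /w /= adjM adjK (bigD1 k) //= !mulmxA LL eqxx mul1mx.
rewrite -!mulmxA LL eqxx mulmx1 big1 ?addr0 // => l lk.
by rewrite !mulmxA LL (negPf lk) raddf0 !mul0mx.
Qed.

End FactorLower.

End ConditionalEntropy.

(** * Continuity of conditional entropy *)

Section TensorFactor.
Context {R : realType}.
Local Notation C := (R[i]).
Implicit Types m n p d : nat.

Definition bra m p (k : 'I_m) : 'M[C]_(p, m * p) :=
  \matrix_(i, j) (j == mxtens_index (k, i))%:R.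

Lemma bra_mul m p q (k : 'I_m) (A : 'M[C]_(m * p, q)) i j :
  (bra p k *m A) i j = A (mxtens_index (k, i)) j.
Proof.
rewrite mxE (bigD1 (mxtens_index (k, i))) //= mxE eqxx mul1r.
by rewrite big1 ?addr0 // => l li; rewrite mxE (negPf li) mul0r.
Qed.

Lemma mul_bra m p q (k : 'I_m) (A : 'M[C]_(q, m * p)) i j :
  (A *m adj (bra p k)) i j = A i (mxtens_index (k, j)).
Proof.
rewrite mxE (bigD1 (mxtens_index (k, j))) //= adj_mxE mxE eqxx rmorph1 mulr1.
rewrite big1 ?addr0 // => l li.
by rewrite adj_mxE mxE (negPf li) rmorph0 mulr0.
Qed.

Lemma mxtens_index_eq m p (i k : 'I_m) (j l : 'I_p) :
  (mxtens_index (i, j) == mxtens_index (k, l)) = (i == k) && (j == l).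
Proof. by rewrite (can_eq (@mxtens_indexK m p)). Qed.

Lemma sum_mxtens m p (V : zmodType) (F : 'I_(m * p) -> V) :
  \sum_i F i = \sum_(k < m) \sum_(i < p) F (mxtens_index (k, i)).
Proof.
rewrite pair_bigA (reindex (@mxtens_index m p)) /=.
  by apply: eq_bigr => -[].
by exists (@mxtens_unindex m p) => i _; rewrite ?mxtens_indexK ?mxtens_unindexK.
Qed.

Lemma bra_factor m p : (0 < m)%N -> factor (@bra m p).
Proof.
move=> m0; split=> // [k l|].
  apply/matrixP => i j; rewrite mul_bra mxE mxtens_index_eq !mxE (eq_sym l) (eq_sym j).
  by case: (k == l); case: (i == j).
apply/matrixP => i j; rewrite summxE.
transitivity (\sum_x (i == x)%:R * (j == x)%:R : C).
  rewrite sum_mxtens; apply: eq_bigr => k _; rewrite mxE.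
  by apply: eq_bigr => l _; rewrite adj_mxE !mxE rmorph_nat.
rewrite (bigD1 i) //= big1 => [|x xi].
  by rewrite eqxx mul1r addr0 mxE eq_sym.
by rewrite eq_sym (negPf xi) mul0r.
Qed.

Lemma ptr_bra m p (A : 'M[C]_(m * p)) : ptr (@bra m p) A = ptrace_l A.
Proof.
apply/matrixP => i j; rewrite summxE mxE; apply: eq_bigr => k _.
by rewrite mul_bra bra_mul.
Qed.

Lemma ent_subadd n (A B : 'M[C]_n) : psdmx A -> psdmx B ->
  ent (A + B) <= ent A + ent B.
Proof.
move=> hA hB.
have := @ent_sum_le R 2 n (2 * n) _ (@bra_factor 2 n isT)
   (fun k => if k == 0 then A else B).
rewrite !big_ord_recl !big_ord0 /= !addr0; apply => k.
by case: ifP.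
Qed.

(** Upper counterpart of [condentD]: the joint entropy is subadditive, while [ent_subadd_traces]
    controls the marginals. *)
Lemma condent_upper d p n (L : 'I_d -> 'M[C]_(p, n)) (A B : 'M[C]_n) (r : R) :
  factor L -> 0 < r < 1 -> psdmx A -> psdmx B ->
  condent L (A + B) <=
    condent L A + condent L B - rtr A * ln r - rtr B * ln (1 - r).
Proof.
move=> fL hr hA hB; have h1 := ent_subadd hA hB.
have := ent_subadd_traces hr (ptr_psd L hA) (ptr_psd L hB).
rewrite !(rtr_ptr fL) /condent ptrD; move: h1.
by do 6!move: (ent _) => ?; lra.
Qed.

End TensorFactor.

(** * Trace norm and the Alicki-Fannes estimate *)

Section Continuity.
Context {R : realType}.
Local Notation C := (R[i]).
Implicit Types m n p d : nat.

Lemma trnorm_herm n (X : 'M[C]_n) : adj X = X ->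
  trnorm X = rtr (fmx Num.norm X).
Proof.
move=> hX; have Uu := spectral_unitary X.
rewrite /trnorm -adjE hX -[LHS]/(\sum_i Num.sqrt (spec (X *m X) i)) -rtr_fmx.
have -> : X *m X = sandwich (spectralmx X) (fun i => spec X i * spec X i).
  by rewrite {1 2}(herm_spectralE hX) sandwichM.
rewrite (fmx_sandwich _ _ Uu) !(rtr_sandwich _ Uu); apply: eq_bigr => i _.
by rewrite -expr2 sqrtr_sqr.
Qed.

(* Alicki-Fannes: evaluate [f] on [(1 - e) rho + P = (1 - e) sigma + Q], where
   [P] and [Q] are positive of trace [e]. *)
Lemma entropic_continuity n (f : 'M[C]_n -> R) (l e : R) (rho sigma : 'M[C]_n) :
  (forall A B, psdmx A -> psdmx B -> f A + f B <= f (A + B)) ->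
  (forall (a : R) A, 0 <= a -> psdmx A -> f (a%:C *: A) = a * f A) ->
  (forall A, psdmx A -> - (rtr A * l) <= f A <= rtr A * l) ->
  (forall (r : R) A B, 0 < r < 1 -> psdmx A -> psdmx B ->
     f (A + B) <= f A + f B - rtr A * ln r - rtr B * ln (1 - r)) ->
  psdmx rho -> psdmx sigma -> rtr rho = 1 -> rtr sigma = 1 ->
  0 < e < 1 -> trnorm (rho - sigma) <= e ->
  f rho - f sigma <= 4 * e * l + xln (1 - e) + xln e.
Proof.
move=> fD fZ fb fu hr hs tr_r tr_s /andP[e0 e1].
have hX : adj (rho - sigma) = rho - sigma.
  by rewrite adjB (psd_herm hr) (psd_herm hs).
rewrite trnorm_herm //; set X := rho - sigma in hX *.
set T := fmx _ X => te.
have hT : psdmx T by apply: sandwich_psd => i; apply: normr_ge0.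
(* The multiple of [rho] pads [P] and [Q] to trace exactly e. *)
pose P := T + (e - rtr T)%:C *: rho.
pose Q := (1 - e)%:C *: X + T + (e - rtr T)%:C *: rho.
have ge0 : 0 <= e - rtr T by rewrite subr_ge0.
have hP : psdmx P := psdD hT (psdZ ge0 hr).
have hQ : psdmx Q.
  apply: (psdD _ (psdZ ge0 hr)).
  (* Positivity of [Q]: every eigenvalue x of rho - sigma satisfies (1 - e) x + |x| >= 0. *)
  have -> : (1 - e)%:C *: X + T =
     sandwich (spectralmx X) (fun i => (1 - e) * spec X i + `|spec X i|).
    rewrite {1}(herm_spectralE hX) /T /fmx /sandwich scalemxAl scalemxAr.
    rewrite -mulmxDl -mulmxDr; congr (_ *m _ *m _).
    apply/matrixP => i j; rewrite !mxE.
    by case: (i == j); rewrite ?mulr0n ?mulr0 ?addr0 // !mulr1n -rmorphM -rmorphD.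
  apply: sandwich_psd => i.
  have := ler_norm (- spec X i); rewrite normrN.
  by have := normr_ge0 (spec X i); nra.
have tP : rtr P = e by rewrite rtrD rtrZ tr_r; ring.
have tQ : rtr Q = e by rewrite !rtrD !rtrZ rtrB tr_r tr_s; ring.
have E : (1 - e)%:C *: rho + P = (1 - e)%:C *: sigma + Q.
  rewrite /P /Q /X scalerBr; move: (_ *: sigma) => S.
  by rewrite !addrA (addrC S) addrK.
have e1' : 0 <= 1 - e by lra.
have h1 := fD _ _ (psdZ e1' hr) hP.
have he : 0 < 1 - e < 1 by lra.
have := fu (1 - e) _ _ he (psdZ e1' hs) hQ.
rewrite -E !fZ // rtrZ tr_s tQ mulr1 (_ : 1 - (1 - e) = e); last by ring.
rewrite fZ // in h1.
(* The constant 4 is 2 + 2: f Q - f P <= 2 e l, and e (f rho - f sigma) <= 2 e l completes the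
   factor 1 - e to 1. *)
have := fb _ hP; have := fb _ hQ; have := fb _ hr; have := fb _ hs.
rewrite tP tQ tr_r tr_s /xln => /andP[? ?] /andP[? ?] /andP[? ?] /andP[? ?].
by nra.
Qed.

End Continuity.

(** * The key gain as a difference of conditional entropies *)

Section KeyGain.
Context {R : realType}.
Local Notation C := (R[i]).
Implicit Types m n p d : nat.

Lemma adj_bra_mul m p q (k t : 'I_m) (A : 'M[C]_(p, q)) i j :
  (adj (bra p k) *m A) (mxtens_index (t, i)) j = (t == k)%:R * A i j.
Proof.
rewrite mxE (bigD1 i) //= big1 ?addr0 => [|l li].
  by rewrite adj_mxE mxE mxtens_index_eq eqxx andbT rmorph_nat.
by rewrite adj_mxE mxE mxtens_index_eq eq_sym (eq_sym i) (negPf li) andbF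
  rmorph0 mul0r.
Qed.

Lemma ptrace_lZ m n (a : C) (A : 'M[C]_(m * n)) :
  ptrace_l (a *: A) = a *: ptrace_l A.
Proof.
apply/matrixP => i j; rewrite !mxE mulr_sumr.
by apply: eq_bigr => k _; rewrite mxE.
Qed.

Lemma ptrace_rZ m n (a : C) (A : 'M[C]_(m * n)) :
  ptrace_r (a *: A) = a *: ptrace_r A.
Proof.
apply/matrixP => i j; rewrite !mxE mulr_sumr.
by apply: eq_bigr => k _; rewrite mxE.
Qed.

Lemma ptrace_lD m n (A B : 'M[C]_(m * n)) :
  ptrace_l (A + B) = ptrace_l A + ptrace_l B.
Proof.
apply/matrixP => i j; rewrite !mxE -big_split.
by apply: eq_bigr => k _; rewrite mxE.
Qed.

Lemma ptrace_rD m n (A B : 'M[C]_(m * n)) :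
  ptrace_r (A + B) = ptrace_r A + ptrace_r B.
Proof.
apply/matrixP => i j; rewrite !mxE -big_split.
by apply: eq_bigr => k _; rewrite mxE.
Qed.

Lemma ptrace_l0 m n : ptrace_l (0 : 'M[C]_(m * n)) = 0.
Proof. by rewrite -[0](scale0r 0) ptrace_lZ scale0r. Qed.

Lemma ptrace_r0 m n : ptrace_r (0 : 'M[C]_(m * n)) = 0.
Proof. by rewrite -[0](scale0r 0) ptrace_rZ scale0r. Qed.

Lemma mxtrace_ptrace_l m n (A : 'M[C]_(m * n)) : \tr (ptrace_l A) = \tr A.
Proof.
rewrite /mxtrace sum_mxtens exchange_big; apply: eq_bigr => i _ /=.
by rewrite mxE.
Qed.

Lemma mxtrace_ptrace_r m n (A : 'M[C]_(m * n)) : \tr (ptrace_r A) = \tr A.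
Proof. by rewrite /mxtrace sum_mxtens; apply: eq_bigr => i _; rewrite mxE. Qed.

Lemma ptrace_l_psd m n (A : 'M[C]_(m * n)) : psdmx A -> psdmx (ptrace_l A).
Proof. by move=> hA; rewrite -ptr_bra; apply: ptr_psd. Qed.

(** The operator 1 (x) <k|, counterpart of [bra] for the right factor. *)
Definition ket_r m n (k : 'I_n) : 'M[C]_(m, m * n) :=
  \matrix_(i, j) (j == mxtens_index (i, k))%:R.

Lemma ptrace_r_psd m n (A : 'M[C]_(m * n)) : psdmx A -> psdmx (ptrace_r A).
Proof.
move=> hA; suff -> : ptrace_r A = \sum_k ket_r m k *m A *m adj (ket_r m k).
  by apply: psd_sum => k; apply: psd_congr.
apply/matrixP => i j; rewrite summxE mxE; apply: eq_bigr => k _.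
rewrite mxE (bigD1 (mxtens_index (j, k))) //= adj_mxE [ket_r _ _ _ _]mxE eqxx rmorph1 mulr1.
rewrite big1 ?addr0 => [|l li]; last first.
  by rewrite adj_mxE [ket_r _ _ _ _]mxE (negPf li) rmorph0 mulr0.
rewrite mxE (bigD1 (mxtens_index (i, k))) //= mxE eqxx mul1r.
by rewrite big1 ?addr0 // => l li; rewrite mxE (negPf li) mul0r.
Qed.

Section ClassicalQuantum.
Context n m (W : 'I_n -> 'I_m -> R).

(** The shape of [cq_state] with arbitrary conditional operators, so that its B and E marginals have
    this shape again. *)
Definition cqmx p (Om : 'I_n -> 'M[C]_p) : 'M[C]_(m * (n * p)) :=
  \sum_t \sum_x (W x t)%:C *: ((delta_mx t t : 'M[C]_m) *t
      ((delta_mx x x : 'M[C]_n) *t Om x)).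

Lemma cqmxE p (Om : 'I_n -> 'M[C]_p) t x i t' x' j :
  cqmx Om (mxtens_index (t, mxtens_index (x, i)))
          (mxtens_index (t', mxtens_index (x', j))) =
  (t == t')%:R * ((x == x')%:R * ((W x t)%:C * Om x i j)).
Proof.
rewrite summxE (bigD1 t) //= [X in _ + X]big1 ?addr0 => [|s st]; last first.
  rewrite summxE big1 // => y _; rewrite mxE !tensmxE mxE [t == s]eq_sym.
  by rewrite (negPf st) mul0r mulr0.
rewrite summxE (bigD1 x) //= big1 ?addr0 => [|y yx]; last first.
  rewrite mxE !tensmxE [delta_mx y y _ _]mxE [x == y]eq_sym (negPf yx).
  by rewrite mul0r !mulr0.
rewrite mxE !tensmxE !mxE !eqxx /= [t' == t]eq_sym [x' == x]eq_sym.
by ring.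
Qed.

Lemma on_r_cqmx p q (Phi : 'M[C]_p -> 'M[C]_q) (Om : 'I_n -> 'M[C]_p) :
  (forall (a : C) X, Phi (a *: X) = a *: Phi X) ->
  on_r (on_r Phi) (cqmx Om) = cqmx (fun x => Phi (Om x)).
Proof.
move=> PhiZ; apply/matrixP => i j.
case: (mxtens_indexP i) => t i'; case: (mxtens_indexP i') => x k.
case: (mxtens_indexP j) => t' j'; case: (mxtens_indexP j') => x' l.
rewrite cqmxE mxE !mxtens_indexK mxE !mxtens_indexK /=.
set X := (X in Phi X); have -> : X =
    ((t == t')%:R * ((x == x')%:R * (W x t)%:C)) *: Om x.
  by apply/matrixP => a b; rewrite !mxE cqmxE !mulrA.
by rewrite PhiZ mxE !mulrA.
Qed.

(** Each block keeps only the trace of [Om x], which B and E share; this is why S(XT) drops out of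
    the key gain. *)
Lemma cqmx_traceTX p q (Om : 'I_n -> 'M[C]_p) (Om' : 'I_n -> 'M[C]_q) :
  (forall x, \tr (Om x) = \tr (Om' x)) ->
  on_r (@ptrace_r _ n p) (cqmx Om) = on_r (@ptrace_r _ n q) (cqmx Om').
Proof.
move=> trE; apply/matrixP => i j.
case: (mxtens_indexP i) => t x; case: (mxtens_indexP j) => t' x'.
have E r (Om0 : 'I_n -> 'M[C]_r) : on_r (@ptrace_r _ n r) (cqmx Om0)
   (mxtens_index (t, x)) (mxtens_index (t', x')) =
   (t == t')%:R * ((x == x')%:R * ((W x t)%:C * \tr (Om0 x))).
  rewrite mxE !mxtens_indexK mxE /= !mulr_sumr; apply: eq_bigr => k _.
  by rewrite mxE cqmxE.
by rewrite !E trE.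
Qed.

Lemma cqmx_traceT p q (Om : 'I_n -> 'M[C]_p) (Om' : 'I_n -> 'M[C]_q) :
  (forall x, \tr (Om x) = \tr (Om' x)) ->
  ptrace_r (cqmx Om) = ptrace_r (cqmx Om').
Proof.
move=> trE; apply/matrixP => t t'.
have E r (Om0 : 'I_n -> 'M[C]_r) : ptrace_r (cqmx Om0) t t' =
   \sum_x (t == t')%:R * ((W x t)%:C * \tr (Om0 x)).
  rewrite mxE sum_mxtens; apply: eq_bigr => x _.
  rewrite !mulr_sumr; apply: eq_bigr => k _.
  by rewrite cqmxE eqxx mul1r.
by rewrite !E; apply: eq_bigr => x _; rewrite trE.
Qed.

(** The unnormalised operator given output t; applied to a POVM it yields the coarse-grained element
    M_t. *)
Definition mixture p (Om : 'I_n -> 'M[C]_p) (t : 'I_m) : 'M[C]_p :=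
  \sum_x (W x t)%:C *: Om x.

Hypothesis W_channel : channel W.

Lemma mixture_psd p (Om : 'I_n -> 'M[C]_p) t : (forall x, psdmx (Om x)) ->
  psdmx (mixture Om t).
Proof.
move=> hOm; apply: psd_sum => x.
exact: (psdZ (W_channel.1 x t) (hOm x)).
Qed.

Lemma blocks_ent k p (B : 'I_k -> 'M[C]_p) (A : 'M[C]_(k * p)) :
  (0 < k)%N -> (forall t, psdmx (B t)) ->
  (forall t i t' j, A (mxtens_index (t, i)) (mxtens_index (t', j)) =
    (t == t')%:R * B t i j) ->
  adj A = A /\ ent A = \sum_t ent (B t).
Proof.
move=> k0 hB AE; have hB' t := psd_herm (hB t).
have hA : adj A = A.
  apply/matrixP => i j.
  case: (mxtens_indexP i) => t a; case: (mxtens_indexP j) => t' b.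
  rewrite adj_mxE !AE rmorphM rmorph_nat eq_sym; case: eqP => [->|]; last first.
    by rewrite !mul0r.
  by rewrite -{2}(hB' t') adj_mxE.
split => //; have [_ LL sumLL] := @bra_factor R k p k0.
apply: (ent_blocks hA hB' _ sumLL) => t; first by rewrite LL eqxx.
apply/matrixP => i j; case: (mxtens_indexP i) => t' a.
by rewrite mul_bra adj_bra_mul AE; case: eqP => [->|]; rewrite ?mul0r.
Qed.

(** Block diagonality is used twice, over t and then over x. The Shannon part due to [W] sees [Om]
    only through traces. *)
Lemma cqmx_ent p (Om : 'I_n -> 'M[C]_p) : (0 < n)%N -> (0 < m)%N ->
  (forall x, psdmx (Om x)) ->
  ent (cqmx Om) = \sum_x ent (Om x) +
                  \sum_x rtr (Om x) * \sum_t xln (W x t).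
Proof.
move=> n0 m0 hOm.
pose B t : 'M[C]_(n * p) :=
  \sum_x adj (bra p x) *m ((W x t)%:C *: Om x) *m bra p x.
have hWOm t x : psdmx ((W x t)%:C *: Om x) := psdZ (W_channel.1 x t) (hOm x).
have hB t : psdmx (B t).
  apply: psd_sum => x.
  by have := psd_congr (adj (bra p x)) (hWOm t x); rewrite adjK.
have BE t x i x' j : B t (mxtens_index (x, i)) (mxtens_index (x', j)) =
    (x == x')%:R * ((W x t)%:C *: Om x) i j.
  rewrite summxE (bigD1 x) //= big1 ?addr0 => [|y yx]; last first.
    by rewrite -mulmxA adj_bra_mul eq_sym (negPf yx) mul0r.
  rewrite -mulmxA adj_bra_mul eqxx mul1r mxE (bigD1 j) //= big1 => [|l lj].
    by rewrite addr0 [bra _ _ _ _]mxE mxtens_index_eq eqxx andbT mulrC eq_sym.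
  by rewrite [bra _ _ _ _]mxE mxtens_index_eq [j == l]eq_sym (negPf lj) andbF mulr0.
have CE t i t' j : cqmx Om (mxtens_index (t, i)) (mxtens_index (t', j)) =
    (t == t')%:R * B t i j.
  case: (mxtens_indexP i) => x a; case: (mxtens_indexP j) => y b.
  by rewrite cqmxE BE mxE.
have [_ ->] := blocks_ent m0 hB CE.
transitivity (\sum_t \sum_x (W x t * ent (Om x) + xln (W x t) * rtr (Om x))).
  apply: eq_bigr => t _.
  have [_ ->] := blocks_ent n0 (hWOm t) (BE t).
  by apply: eq_bigr => x _; rewrite (ent_scale (W_channel.1 x t) (hOm x)).
rewrite exchange_big -big_split; apply: eq_bigr => x _ /=.
rewrite big_split -mulr_suml (W_channel.2 x) mul1r mulr_sumr; congr (_ + _).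
by apply: eq_bigr => t _; rewrite mulrC.
Qed.

Lemma cqmx_entTY p (Om : 'I_n -> 'M[C]_p) : (0 < m)%N ->
  (forall x, psdmx (Om x)) ->
  ent (on_r (@ptrace_l _ n p) (cqmx Om)) = \sum_t ent (mixture Om t).
Proof.
move=> m0 hOm; apply: (blocks_ent m0 _ _).2 => [t|]; first exact: (mixture_psd t hOm).
move=> t i t' j; rewrite mxE !mxtens_indexK mxE summxE mulr_sumr /=.
by apply: eq_bigr => x _; rewrite mxE cqmxE eqxx mul1r [in RHS]mxE.
Qed.

(** S(XT), S(T) and the Shannon part agree for B and E. What survives is S(E) - S(B), summed over x
    and over t with opposite signs. *)
Lemma key_gain_cqmx p q (Om : 'I_n -> 'M[C]_(p * q)) : (0 < n)%N -> (0 < m)%N ->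
  (forall x, psdmx (Om x)) ->
  key_gain (cqmx Om) =
  (\sum_x (ent (ptrace_l (Om x)) - ent (ptrace_r (Om x))) -
   \sum_t (ent (mixture (fun x => ptrace_l (Om x)) t) -
           ent (mixture (fun x => ptrace_r (Om x)) t))) / ln 2.
Proof.
move=> n0 m0 hOm; rewrite /key_gain !on_r_cqmx; last first.
- by move=> a X; exact: ptrace_rZ.
- by move=> a X; exact: ptrace_lZ.
have hl x := ptrace_l_psd (hOm x); have hr x := ptrace_r_psd (hOm x).
have trE x : \tr (ptrace_l (Om x)) = \tr (ptrace_r (Om x)).
  by rewrite mxtrace_ptrace_l mxtrace_ptrace_r.
rewrite /cond_mutual_info (cqmx_traceTX trE) (cqmx_traceT trE) !vN_entropyE.
rewrite (cqmx_entTY m0 hl) (cqmx_entTY m0 hr) (cqmx_ent n0 m0 hl)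
  (cqmx_ent n0 m0 hr).
have -> : \sum_x rtr (ptrace_l (Om x)) * \sum_t xln (W x t) =
          \sum_x rtr (ptrace_r (Om x)) * \sum_t xln (W x t).
  by apply: eq_bigr => x _; rewrite /rtr trE.
rewrite !sumrB -!mulrDl -!mulrBl; congr (_ / _).
by do !move: (\sum_(_ <- _) _) => ?; ring.
Qed.

End ClassicalQuantum.

End KeyGain.

(** * Measuring one side of a pure state *)

Section Measurement.
Context {R : realType}.
Local Notation C := (R[i]).

Lemma local_mul m p q (K : 'M[C]_m) (X : 'M[C]_(m * p, q)) a i j :
  ((K *t (1%:M : 'M[C]_p)) *m X) (mxtens_index (a, i)) j =
  \sum_b K a b * X (mxtens_index (b, i)) j.
Proof.
rewrite mxE sum_mxtens; apply: eq_bigr => b _.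
rewrite (bigD1 i) //= big1 => [|k ki]; rewrite tensmxE mxE ?eqxx ?mulr1 ?addr0 //.
by rewrite eq_sym (negPf ki) mulr0 mul0r.
Qed.

Lemma mul_local m p q (K : 'M[C]_m) (X : 'M[C]_(q, m * p)) a i j :
  (X *m (K *t (1%:M : 'M[C]_p))) i (mxtens_index (a, j)) =
  \sum_b X i (mxtens_index (b, j)) * K b a.
Proof.
rewrite mxE sum_mxtens; apply: eq_bigr => b _.
rewrite (bigD1 j) //= big1 => [|k kj]; rewrite tensmxE mxE ?eqxx ?mulr1 ?addr0 //.
by rewrite (negPf kj) !mulr0.
Qed.

Lemma adj_local m p (K : 'M[C]_m) :
  adj (K *t (1%:M : 'M[C]_p)) = adj K *t 1%:M.
Proof.
apply/matrixP => i j; case: (mxtens_indexP i) => a b.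
case: (mxtens_indexP j) => c d.
by rewrite adj_mxE !tensmxE rmorphM adj_mxE !mxE rmorph_nat eq_sym.
Qed.

Lemma ptrace_l_cyc m p (K : 'M[C]_m) (X : 'M[C]_(m * p)) :
  ptrace_l (X *m (K *t 1%:M)) = ptrace_l ((K *t 1%:M) *m X).
Proof.
apply/matrixP => i j; rewrite !mxE.
under eq_bigr do rewrite mul_local.
under [RHS]eq_bigr do rewrite local_mul.
by rewrite exchange_big; do 2![apply: eq_bigr => ? _]; rewrite mulrC.
Qed.

Lemma on_r_ptrace_rE m n p (X : 'M[C]_(m * (n * p))) a b a' b' :
  on_r (@ptrace_r R n p) X (mxtens_index (a, b)) (mxtens_index (a', b')) =
  \sum_e X (mxtens_index (a, mxtens_index (b, e)))
           (mxtens_index (a', mxtens_index (b', e))).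
Proof.
rewrite mxE !mxtens_indexK mxE /=; apply: eq_bigr => e _.
by rewrite mxE.
Qed.

Lemma on_r_ptrace_r_mul m n p (K : 'M[C]_m) (X : 'M[C]_(m * (n * p))) :
  on_r (@ptrace_r R n p) ((K *t 1%:M) *m X) =
  (K *t 1%:M) *m on_r (@ptrace_r R n p) X.
Proof.
apply/matrixP => i j; case: (mxtens_indexP i) => a b.
case: (mxtens_indexP j) => a' b'; rewrite local_mul on_r_ptrace_rE.
under eq_bigr do rewrite local_mul.
rewrite exchange_big; apply: eq_bigr => c _ /=.
by rewrite on_r_ptrace_rE mulr_sumr.
Qed.

Lemma on_r_mul_ptrace_r m n p (K : 'M[C]_m) (X : 'M[C]_(m * (n * p))) :
  on_r (@ptrace_r R n p) (X *m (K *t 1%:M)) =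
  on_r (@ptrace_r R n p) X *m (K *t 1%:M).
Proof.
apply/matrixP => i j; case: (mxtens_indexP i) => a b.
case: (mxtens_indexP j) => a' b'; rewrite mul_local on_r_ptrace_rE.
under eq_bigr do rewrite mul_local.
rewrite exchange_big; apply: eq_bigr => c _ /=.
by rewrite on_r_ptrace_rE mulr_suml.
Qed.

Lemma ptrace_l_on_r m n p (X : 'M[C]_(m * (n * p))) :
  ptrace_l (on_r (@ptrace_r R n p) X) = ptrace_r (ptrace_l X).
Proof.
apply/matrixP => i j; rewrite !mxE.
under eq_bigr do rewrite on_r_ptrace_rE.
by rewrite exchange_big; apply: eq_bigr => e _ /=; rewrite mxE.
Qed.

(** With [v] read as a matrix N from E to AB, the marginals are N adj N and the transpose of adj N
    N. *)
Lemma ent_marginals_pure m n p (v : 'cV[C]_(m * (n * p))) :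
  ent (on_r (@ptrace_r R n p) (v *m adj v)) =
  ent (ptrace_l (ptrace_l (v *m adj v))).
Proof.
pose N : 'M[C]_(m * n, p) := \matrix_(i, e)
  v (mxtens_index ((mxtens_unindex i).1, mxtens_index ((mxtens_unindex i).2, e))) 0.
have vE i j : (v *m adj v) i j = v i 0 * (v j 0)^*%R.
  by rewrite mxE big_ord1 adj_mxE.
have -> : on_r (@ptrace_r R n p) (v *m adj v) = N *m adj N.
  apply/matrixP => i j; case: (mxtens_indexP i) => a b.
  case: (mxtens_indexP j) => a' b'; rewrite on_r_ptrace_rE [RHS]mxE.
  apply: eq_bigr => e _; rewrite vE adj_mxE.
  by rewrite ![N _ _]mxE !mxtens_indexK.
have -> : ptrace_l (ptrace_l (v *m adj v)) = (adj N *m N)^T.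
  apply/matrixP => i j; rewrite mxE [RHS]mxE [RHS]mxE sum_mxtens.
  under eq_bigr do rewrite mxE.
  rewrite exchange_big; apply: eq_bigr => a _; apply: eq_bigr => b _ /=.
  by rewrite vE adj_mxE ![N _ _]mxE !mxtens_indexK mulrC.
by rewrite ent_tr ?adjM ?adjK // ent_mulC.
Qed.

Section Filtered.
Context dA dB dE (v : 'cV[C]_(dA * (dB * dE))).

(* Unnormalised state of BE after the outcome [Q] on A. *)
Definition post (Q : 'M[C]_dA) : 'M[C]_(dB * dE) :=
  ptrace_l (v *m adj v *m (Q *t (1%:M : 'M[C]_(dB * dE)))).

Definition post_gap (Q : 'M[C]_dA) : R :=
  ent (ptrace_l (post Q)) - ent (ptrace_r (post Q)).

(** Unlike [post], which is linear in [Q], this retains system A, as the conditional entropy S(A|B)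
    requires. *)
Definition filtered d1 d2 (Q : 'M[C]_d1) (rho : 'M[C]_(d1 * d2)) : 'M[C]_(d1 * d2) :=
  (sqrtmx Q *t 1%:M) *m rho *m adj (sqrtmx Q *t (1%:M : 'M[C]_d2)).

Lemma post_filter Q : psdmx Q ->
  post Q = ptrace_l (filtered Q (v *m adj v)).
Proof.
move=> hQ; rewrite /post /filtered adj_local adj_sqrtmx ptrace_l_cyc.
by rewrite ptrace_l_cyc mulmxA tensmx_mul mulmx1 sqrtmxK.
Qed.

Lemma post_psd Q : psdmx Q -> psdmx (post Q).
Proof.
move=> hQ; rewrite post_filter //; apply: ptrace_l_psd.
exact: psd_congr (psd_gram v).
Qed.

(** Filtering keeps the global vector pure, so E has the entropy of AB and the gap is S(AB) - S(B),
    a function of the AB marginal. *)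
Lemma post_gap_condent Q : psdmx Q ->
  post_gap Q = condent (@bra R dA dB)
    (filtered Q (on_r (@ptrace_r R dB dE) (v *m adj v))).
Proof.
move=> hQ; rewrite /post_gap post_filter //.
have -> : filtered Q (on_r (@ptrace_r R dB dE) (v *m adj v)) =
   on_r (@ptrace_r R dB dE) (filtered Q (v *m adj v)).
  by rewrite /filtered !adj_local on_r_mul_ptrace_r on_r_ptrace_r_mul.
rewrite -ptrace_l_on_r /condent ptr_bra.
set w := (sqrtmx Q *t 1%:M) *m v.
have -> : filtered Q (v *m adj v) = w *m adj w.
  by rewrite /filtered /w adjM !mulmxA.
by rewrite ent_marginals_pure.
Qed.

Lemma postD Q1 Q2 : post (Q1 + Q2) = post Q1 + post Q2.
Proof.
rewrite /post -ptrace_lD -mulmxDr; congr (ptrace_l (_ *m _)).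
by apply/matrixP => i j; rewrite !mxE mulrDl.
Qed.

Lemma postZ (a : C) Q : post (a *: Q) = a *: post Q.
Proof.
rewrite /post -ptrace_lZ scalemxAr; congr (ptrace_l (_ *m _)).
by apply/matrixP => i j; rewrite !mxE mulrA.
Qed.

Lemma post_sum (I : finType) (Q : I -> 'M[C]_dA) :
  post (\sum_i Q i) = \sum_i post (Q i).
Proof.
elim/big_rec2: _ => [|i X Y _ <-]; last by rewrite postD.
by rewrite -[0](scale0r 0) postZ scale0r.
Qed.

Lemma post_mixture n m (W : 'I_n -> 'I_m -> R) (Q : 'I_n -> 'M[C]_dA) t :
  mixture W (fun x => post (Q x)) t = post (mixture W Q t).
Proof. by rewrite /mixture post_sum; apply: eq_bigr => x _; rewrite postZ. Qed.

Lemma ptrace_l_mixture n m (W : 'I_n -> 'I_m -> R) a b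
    (Om : 'I_n -> 'M[C]_(a * b)) t :
  mixture W (fun x => ptrace_l (Om x)) t = ptrace_l (mixture W Om t).
Proof.
rewrite /mixture; elim/big_rec2: _ => [|x X Y _ ->]; first by rewrite ptrace_l0.
by rewrite ptrace_lD ptrace_lZ.
Qed.

Lemma ptrace_r_mixture n m (W : 'I_n -> 'I_m -> R) a b
    (Om : 'I_n -> 'M[C]_(a * b)) t :
  mixture W (fun x => ptrace_r (Om x)) t = ptrace_r (mixture W Om t).
Proof.
rewrite /mixture; elim/big_rec2: _ => [|x X Y _ ->]; first by rewrite ptrace_r0.
by rewrite ptrace_rD ptrace_rZ.
Qed.

Lemma key_gainE n m (Q : 'I_n -> 'M[C]_dA) (W : 'I_n -> 'I_m -> R) :
  (0 < n)%N -> (0 < m)%N -> (forall x, psdmx (Q x)) -> channel W ->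
  key_gain (cq_state (v *m adj v) Q W) =
  (\sum_x post_gap (Q x) - \sum_t post_gap (mixture W Q t)) / ln 2.
Proof.
move=> n0 m0 hQ hW.
rewrite -[cq_state _ _ _]/(cqmx W (fun x => post (Q x))).
rewrite (key_gain_cqmx hW n0 m0 (fun x => post_psd (hQ x))).
congr ((_ - _) / _); apply: eq_bigr => t _.
by rewrite ptrace_l_mixture ptrace_r_mixture post_mixture.
Qed.

End Filtered.

End Measurement.

(** * Symmetric extendible states *)

Section SymmetricExtension.
Context {R : realType}.
Local Notation C := (R[i]).

Definition swapB dA dB : 'M[C]_(dA * (dB * dB)) := (1%:M : 'M[C]_dA) *t swapmx dB.

Lemma swapBE dA dB a b c (j : 'I_(dA * (dB * dB))) :
  @swapB dA dB (mxtens_index (a, mxtens_index (b, c))) j =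
  (j == mxtens_index (a, mxtens_index (c, b)))%:R.
Proof.
case: (mxtens_indexP j) => a' j'; case: (mxtens_indexP j') => b' c'.
rewrite tensmxE !mxE !mxtens_indexK !mxtens_index_eq xpair_eqE /=.
rewrite -natrM mulnb [a' == a]eq_sym [b' == c]eq_sym [c' == b]eq_sym.
by rewrite [(b == c') && _]andbC.
Qed.

Lemma swapB_mul dA dB q (X : 'M[C]_(dA * (dB * dB), q)) a b c j :
  (swapB dA dB *m X) (mxtens_index (a, mxtens_index (b, c))) j =
  X (mxtens_index (a, mxtens_index (c, b))) j.
Proof.
rewrite mxE (bigD1 (mxtens_index (a, mxtens_index (c, b)))) //=.
rewrite swapBE eqxx mul1r big1 ?addr0 // => k ki.
by rewrite swapBE (negPf ki) mul0r.
Qed.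

Lemma swapB_congr dA dB (X : 'M[C]_(dA * (dB * dB))) a b c a' b' c' :
  (swapB dA dB *m X *m adj (swapB dA dB))
    (mxtens_index (a, mxtens_index (b, c)))
    (mxtens_index (a', mxtens_index (b', c'))) =
  X (mxtens_index (a, mxtens_index (c, b)))
    (mxtens_index (a', mxtens_index (c', b'))).
Proof.
rewrite -[swapB dA dB *m X]adjK -adjM adj_mxE swapB_mul adj_mxE swapB_mul.
by rewrite conjCK.
Qed.

Lemma condent_filter_symext dA dB (sigma : 'M[C]_(dA * dB)) n m
    (Q : 'I_n -> 'M[C]_dA) (W : 'I_n -> 'I_m -> R) :
  (0 < dA)%N -> (0 < dB)%N -> symmetric_extendible sigma ->
  (forall x, psdmx (Q x)) -> channel W ->
  \sum_x condent (@bra R dA dB) (filtered (Q x) sigma) <=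
  \sum_t condent (@bra R dA dB) (filtered (mixture W Q t) sigma).
Proof.
move=> dA0 dB0 [tau [[htau _] tauF tau_sigma]] hQ hW.
rewrite -/(swapB dA dB) -adjE in tauF.
set d := (dA * (dB * dB))%N in tau htau tauF tau_sigma.
have d0 : (0 < d)%N by rewrite /d !muln_gt0 dA0 dB0.
have tauE a b c a' b' c' :
    tau (mxtens_index (a, mxtens_index (b, c)))
        (mxtens_index (a', mxtens_index (b', c'))) =
    tau (mxtens_index (a, mxtens_index (c, b)))
        (mxtens_index (a', mxtens_index (c', b'))).
  by rewrite -{1}tauF swapB_congr.
(* [v] purifies [sigma]; its environment is the purifying system of [tau]
   together with [B']. *)
pose v : 'cV[C]_(dA * (dB * (d * dB))) := \col_i
  let: (a, i1) := mxtens_unindex i in let: (b, e) := mxtens_unindex i1 in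
  let: (g, c) := mxtens_unindex e in
  sqrtmx tau (mxtens_index (a, mxtens_index (b, c))) g.
have vE a b g c : v (mxtens_index (a, mxtens_index (b, mxtens_index (g, c)))) 0 =
    sqrtmx tau (mxtens_index (a, mxtens_index (b, c))) g.
  by rewrite mxE !mxtens_indexK.
have vv a b c a' b' c' :
   \sum_(g < d) (v *m adj v)
      (mxtens_index (a, mxtens_index (b, mxtens_index (g, c))))
      (mxtens_index (a', mxtens_index (b', mxtens_index (g, c')))) =
   tau (mxtens_index (a, mxtens_index (b, c)))
       (mxtens_index (a', mxtens_index (b', c'))).
  rewrite -[in RHS](sqrtmxK htau) -{2}(adj_sqrtmx tau) [RHS]mxE.
  apply: eq_bigr => g _; rewrite [LHS]mxE big_ord1 vE !adj_mxE.
  by rewrite vE.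
have vsigma : on_r (@ptrace_r R dB (d * dB)) (v *m adj v) = sigma.
  rewrite -tau_sigma; apply/matrixP => i j.
  case: (mxtens_indexP i) => a b; case: (mxtens_indexP j) => a' b'.
  rewrite !on_r_ptrace_rE sum_mxtens exchange_big.
  by apply: eq_bigr => c _ /=; rewrite vv.
(* The unnormalised state of G B' after outcome P, linear in P. *)
pose omE P := ptrace_l (post v P).
have postE P b e b' e' : post v P (mxtens_index (b, e)) (mxtens_index (b', e')) =
   \sum_a \sum_a' (v *m adj v) (mxtens_index (a, mxtens_index (b, e)))
      (mxtens_index (a', mxtens_index (b', e'))) * P a' a.
  rewrite mxE; apply: eq_bigr => a _.
  by rewrite mul_local.
(* The swap symmetry of [tau] enters here: B and B' are left in the same state by any outcome on
   A. *)
have sym P : ptrace_r (post v P) = ptrace_l (omE P).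
  apply/matrixP => i j; rewrite !mxE sum_mxtens exchange_big.
  transitivity (\sum_c \sum_a \sum_a'
     tau (mxtens_index (a, mxtens_index (i, c)))
         (mxtens_index (a', mxtens_index (j, c))) * P a' a).
    apply: eq_bigr => c _ /=; under eq_bigr do rewrite postE.
    rewrite exchange_big; apply: eq_bigr => a _ /=.
    rewrite exchange_big; apply: eq_bigr => a' _ /=.
    by rewrite -mulr_suml vv.
  under [RHS]eq_bigr do rewrite mxE.
  rewrite [RHS]exchange_big; apply: eq_bigr => c _ /=.
  under [RHS]eq_bigr do rewrite postE.
  rewrite [RHS]exchange_big; apply: eq_bigr => a _ /=.
  rewrite [RHS]exchange_big; apply: eq_bigr => a' _ /=.
  by rewrite -mulr_suml vv tauE.
have gapE P : psdmx P -> condent (@bra R dA dB) (filtered P sigma) =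
    condent (@bra R d dB) (omE P).
  move=> hP; rewrite -vsigma -post_gap_condent // /post_gap sym.
  by rewrite /condent ptr_bra.
have hM t : psdmx (mixture W Q t) := mixture_psd hW t hQ.
have homE P : psdmx P -> psdmx (omE P).
  by move=> hP; apply: ptrace_l_psd; apply: post_psd.
have fL : factor (@bra R d dB) := bra_factor dB d0.
(* Homogeneity splits each x-term over t, as [W x] sums to 1; for each t, superadditivity then
   merges the x-terms into the state for M_t. *)
have -> : \sum_x condent (@bra R dA dB) (filtered (Q x) sigma) =
    \sum_t \sum_x condent (@bra R d dB) ((W x t)%:C *: omE (Q x)).
  rewrite exchange_big; apply: eq_bigr => x _ /=.
  under [RHS]eq_bigr do rewrite (condentZ fL (hW.1 _ _) (homE _ (hQ _))).
  by rewrite -mulr_suml hW.2 mul1r gapE.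
apply: ler_sum => t _; rewrite gapE //.
rewrite /omE -post_mixture -ptrace_l_mixture.
by apply: condent_sum => // x; exact: (psdZ (hW.1 x t) (homE _ (hQ x))).
Qed.

(** The maximally mixed extension is a witness. Nonemptiness lets elements of the set approach its
    infimum [symext_dist]. *)
Lemma symext_nonempty dA dB : (0 < dA)%N -> (0 < dB)%N ->
  exists sigma : 'M[C]_(dA * dB), symmetric_extendible sigma.
Proof.
move=> dA0 dB0; set d := (dA * (dB * dB))%N.
have d0 : (0 < d)%N by rewrite /d !muln_gt0 dA0 dB0.
pose tau : 'M[C]_d := (d%:R^-1)%:C *: 1%:M.
exists (on_r (@ptrace_r R dB dB) tau); exists tau; split => //.
  split; first by apply: psdZ; [rewrite invr_ge0 ler0n|exact: psd1].
  rewrite mxtraceZ mxtrace1 fmorphV rmorph_nat mulVf //.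
  by rewrite pnatr_eq0 -lt0n.
rewrite -/(swapB dA dB) -adjE; apply/matrixP => i j.
case: (mxtens_indexP i) => a i'; case: (mxtens_indexP i') => b c.
case: (mxtens_indexP j) => a' j'; case: (mxtens_indexP j') => b' c'.
rewrite swapB_congr !mxE !mxtens_index_eq.
by rewrite [X in _ && X]andbC.
Qed.

End SymmetricExtension.

(** * The bound *)

Section Bound.
Context {R : realType}.
Local Notation C := (R[i]).

(** * Measured conditional entropy as a function of the state *)

Section MeasuredEntropy.
Context (dA dB : nat) (dA0 : (0 < dA)%N) (n : nat) (Q : 'I_n -> 'M[C]_dA) (hQ : POVM Q).

Definition measured_condent (rho : 'M[C]_(dA * dB)) : R :=
  \sum_x condent (@bra R dA dB) (filtered (Q x) rho).

Let fL : factor (@bra R dA dB) := bra_factor dB dA0.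

Lemma filtered_psd d1 d2 (P : 'M[C]_d1) (rho : 'M[C]_(d1 * d2)) :
  psdmx rho -> psdmx (filtered P rho).
Proof. by move=> h; apply: psd_congr. Qed.

Lemma filteredD d1 d2 (P : 'M[C]_d1) (A B : 'M[C]_(d1 * d2)) :
  filtered P (A + B) = filtered P A + filtered P B.
Proof. by rewrite /filtered mulmxDr mulmxDl. Qed.

Lemma filteredZ d1 d2 (P : 'M[C]_d1) (a : C) (A : 'M[C]_(d1 * d2)) :
  filtered P (a *: A) = a *: filtered P A.
Proof. by rewrite /filtered -scalemxAr -scalemxAl. Qed.

(** Completeness of the POVM: bounds proportional to the trace for each outcome add up to one in the
    trace of [rho], whatever the number of outcomes. *)
Lemma rtr_filter_sum (rho : 'M[C]_(dA * dB)) :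
  \sum_x rtr (filtered (Q x) rho) = rtr rho.
Proof.
have E x : rtr (filtered (Q x) rho) = rtr ((Q x *t 1%:M) *m rho).
  rewrite /filtered adj_local adj_sqrtmx rtr_mulC mulmxA tensmx_mul mulmx1.
  by rewrite (sqrtmxK (hQ.1 x)).
under eq_bigr do rewrite E.
rewrite -rtr_sum -mulmx_suml; congr rtr.
rewrite -[RHS]mul1mx; congr (_ *m _).
transitivity ((\sum_x Q x) *t (1%:M : 'M[C]_dB)); last first.
  rewrite hQ.2; apply/matrixP => i j.
  case: (mxtens_indexP i) => a b; case: (mxtens_indexP j) => c d.
  by rewrite tensmxE !mxE mxtens_index_eq -natrM mulnb.
apply/matrixP => i j; rewrite summxE mxE summxE mulr_suml.
by apply: eq_bigr => x _; rewrite mxE.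
Qed.

Lemma measured_condentD A B : psdmx A -> psdmx B ->
  measured_condent A + measured_condent B <= measured_condent (A + B).
Proof.
move=> hA hB; rewrite /measured_condent -big_split; apply: ler_sum => x _ /=.
by rewrite filteredD; apply: (condentD fL (filtered_psd (Q x) hA) (filtered_psd (Q x) hB)).
Qed.

Lemma measured_condentZ (a : R) A : 0 <= a -> psdmx A ->
  measured_condent (a%:C *: A) = a * measured_condent A.
Proof.
move=> a0 hA; rewrite /measured_condent mulr_sumr; apply: eq_bigr => x _.
by rewrite filteredZ (condentZ fL a0 (filtered_psd (Q x) hA)).
Qed.

Lemma measured_condent_bounds A : psdmx A ->
  - (rtr A * ln dA%:R) <= measured_condent A <= rtr A * ln dA%:R.
Proof.
move=> hA; rewrite -rtr_filter_sum mulr_suml -sumrN.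
apply/andP; split; apply: ler_sum => x _.
  exact: (condent_ge fL (filtered_psd (Q x) hA)).
exact: (condent_le fL (filtered_psd (Q x) hA)).
Qed.

Lemma measured_condent_upper (r : R) A B : 0 < r < 1 -> psdmx A -> psdmx B ->
  measured_condent (A + B) <= measured_condent A + measured_condent B
    - rtr A * ln r - rtr B * ln (1 - r).
Proof.
move=> hr hA hB; rewrite -(rtr_filter_sum A) -(rtr_filter_sum B).
rewrite !mulr_suml -big_split -!sumrB; apply: ler_sum => x _ /=; rewrite filteredD.
exact: (condent_upper fL hr (filtered_psd (Q x) hA) (filtered_psd (Q x) hB)).
Qed.

Lemma measured_condent_continuity (e : R) (rho sigma : 'M[C]_(dA * dB)) :
  psdmx rho -> psdmx sigma -> rtr rho = 1 -> rtr sigma = 1 ->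
  0 < e < 1 -> trnorm (rho - sigma) <= e ->
  measured_condent rho - measured_condent sigma <=
    4 * e * ln dA%:R + xln (1 - e) + xln e.
Proof.
apply: entropic_continuity.
- exact: measured_condentD.
- exact: measured_condentZ.
- exact: measured_condent_bounds.
- exact: measured_condent_upper.
Qed.

End MeasuredEntropy.

Lemma mixture_POVM d n m (Q : 'I_n -> 'M[C]_d) (W : 'I_n -> 'I_m -> R) :
  POVM Q -> channel W -> POVM (mixture W Q).
Proof.
move=> [hQ sQ] hW; split=> [t|]; first exact: (mixture_psd hW t hQ).
rewrite /mixture exchange_big -[RHS]sQ; apply: eq_bigr => x _ /=.
by rewrite -scaler_suml -rmorph_sum hW.2 scale1r.
Qed.

Lemma symext_state dA dB (sigma : 'M[C]_(dA * dB)) :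
  symmetric_extendible sigma -> psdmx sigma /\ rtr sigma = 1.
Proof.
move=> [tau [[htau trtau] _ <-]]; split; last first.
  suff -> : rtr (on_r (@ptrace_r R dB dB) tau) = rtr tau by rewrite /rtr trtau.
  rewrite /rtr /mxtrace !sum_mxtens; congr complex.Re; apply: eq_bigr => a _.
  by rewrite sum_mxtens; apply: eq_bigr => b _; rewrite on_r_ptrace_rE.
have [v ->] := psd_decomp htau.
have -> : on_r (@ptrace_r R dB dB) (\sum_i v i *m adj (v i)) =
    \sum_i on_r (@ptrace_r R dB dB) (v i *m adj (v i)).
  apply/matrixP => i j; case: (mxtens_indexP i) => a b.
  case: (mxtens_indexP j) => a' b'; rewrite summxE on_r_ptrace_rE.
  under [RHS]eq_bigr do rewrite on_r_ptrace_rE.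
  by rewrite exchange_big; apply: eq_bigr => e _ /=; rewrite summxE.
apply: psd_sum => i.
pose N : 'M[C]_(dA * dB, dB) := \matrix_(j, e) v i (mxtens_index
   ((mxtens_unindex j).1, mxtens_index ((mxtens_unindex j).2, e))) 0.
suff -> : on_r (@ptrace_r R dB dB) (v i *m adj (v i)) = N *m adj N.
  exact: psd_gram.
apply/matrixP => k l; case: (mxtens_indexP k) => a b.
case: (mxtens_indexP l) => a' b'; rewrite on_r_ptrace_rE [RHS]mxE.
apply: eq_bigr => e _; rewrite [LHS]mxE big_ord1 !adj_mxE.
by rewrite ![N _ _]mxE !mxtens_indexK.
Qed.

Lemma trnormN n (X : 'M[C]_n) : trnorm (- X) = trnorm X.
Proof.
rewrite /trnorm -!adjE; have -> : adj (- X) = - adj X.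
  by rewrite -[- X]sub0r adjB adj0 sub0r.
by rewrite mulNmx mulmxN opprK.
Qed.

Lemma trnorm_ge0 n (X : 'M[C]_n) : 0 <= trnorm X.
Proof. by apply: sumr_ge0 => i _; apply: sqrtr_ge0. Qed.

Lemma xln_ge0 (x : R) : x <= 1 -> 0 <= xln x.
Proof. by move=> /xln_le_sqrt/andP[]. Qed.

Lemma ord_dim_neq0 n (i : 'I_n) : n <> 0%N.
Proof. by move=> n0; move: (i); rewrite n0 => -[]. Qed.

Lemma state_dim_gt0 n (rho : 'M[C]_n) : state rho -> (0 < n)%N.
Proof.
move=> [_ tr_rho]; rewrite lt0n; apply/eqP => n0; move/eqP: tr_rho.
rewrite /mxtrace big1 ?[0 == _]eq_sym ?oner_eq0 // => i _.
by case: (ord_dim_neq0 i n0).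
Qed.

(** Telescoping through a nearby extendible [sigma], where the difference is at most 0: continuity
    is used for [Q] from [rho] to [sigma] and for the coarse-grained POVM on the way back. *)
Lemma key_gain_bound dA dB n m (Q : 'I_n -> 'M[C]_dA) (W : 'I_n -> 'I_m -> R)
    (rho : 'M[C]_(dA * dB)) : state rho -> POVM Q -> channel W ->
  symext_dist rho <= 1 ->
  measured_condent Q rho - measured_condent (mixture W Q) rho <=
    8 * symext_dist rho * ln dA%:R + 4 * xln (1 - symext_dist rho)
    + 4 * xln (symext_dist rho).
Proof.
move=> [hrho tr_rho] hQ hW; set eps := symext_dist rho => eps1.
have hM := mixture_POVM hQ hW.
have := state_dim_gt0 (conj hrho tr_rho); rewrite muln_gt0 => /andP[dA0 dB0].
have rtr_rho : rtr rho = 1 by rewrite /rtr tr_rho.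
have l0 : 0 <= ln (dA%:R : R) by rewrite ln_ge0 // ler1n.
pose S := [set trnorm (rho - sigma) | sigma in @symmetric_extendible R dA dB].
have S0 : S !=set0.
  have [sigma hs] := @symext_nonempty R dA dB dA0 dB0.
  by exists (trnorm (rho - sigma)); exists sigma.
have eps0 : 0 <= eps.
  by apply: lb_le_inf => // x [sigma _ <-]; exact: trnorm_ge0.
have h0 : 0 <= xln eps by exact: xln_ge0.
have h1 : 0 <= xln (1 - eps) by apply: xln_ge0; lra.
move: (eps1); rewrite le_eqVlt => /predU1P[eps_eq|eps_lt1].
  have := measured_condent_bounds dA0 hQ hrho.
  have := measured_condent_bounds dA0 hM hrho.
  move: (measured_condent Q rho) (measured_condent _ rho) => a b.
  rewrite rtr_rho eps_eq in h0 h1 * => /andP[? ?] /andP[? ?]; lra.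
(* The infimum need not be attained: the estimate is made at every e in (eps, 1), and e then
   decreases to eps. *)
have near_bound e : eps < e < 1 ->
   measured_condent Q rho - measured_condent (mixture W Q) rho <=
   8 * e * ln dA%:R + 2 * xln (1 - e) + 2 * xln e.
  move=> /andP[eps_e e1]; have he : 0 < e < 1 by rewrite (le_lt_trans eps0) // e1.
  have [_ [sigma hs <-] te] := inf_lt S0 eps_e.
  have [psd_s tr_s] := symext_state hs.
  have te' : trnorm (sigma - rho) <= e by rewrite -opprB trnormN ltW.
  have h2 := measured_condent_continuity dA0 hQ hrho psd_s rtr_rho tr_s he (ltW te).
  have h3 := measured_condent_continuity dA0 hM psd_s hrho tr_s rtr_rho he te'.
  have h4 : measured_condent Q sigma <= measured_condent (mixture W Q) sigma.
    exact: condent_filter_symext dA0 dB0 hs hQ.1 hW.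
  move: (measured_condent Q rho) (measured_condent Q sigma)
    (measured_condent (mixture W Q) rho) (measured_condent (mixture W Q) sigma)
    h2 h3 h4 => a b c d h2 h3 h4.
  by lra.
(* The limit carries coefficient 2 on the entropic terms; these are nonnegative, so 2 relaxes to
   4. *)
apply: (@le_trans _ _ (8 * eps * ln dA%:R + 2 * xln (1 - eps) + 2 * xln eps));
  last by lra.
have lim : 8 * e * ln dA%:R + 2 * xln (1 - e) + 2 * xln e @[e --> eps^'+] -->
    8 * eps * ln dA%:R + 2 * xln (1 - eps) + 2 * xln eps.
  have id_cvg : e @[e --> eps^'+] --> eps by apply: cvg_within.
  apply: cvgD; first apply: cvgD.
  - by apply: cvgMr_tmp; apply: cvgMl_tmp.
  - apply: cvgMl_tmp; apply: (cvg_comp _ xln); last exact: continuous_xln.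
    by apply: cvgB; first exact: cvg_cst.
  - by apply: cvgMl_tmp; apply: (cvg_comp _ xln); last exact: continuous_xln.
apply: (ler_cvg_to (cvg_cst _) lim); near=> e.
apply: near_bound; apply/andP; split; near: e.
  exact: nbhs_right_gt.
exact: nbhs_right_lt.
Unshelve. all: by end_near. Qed.

End Bound.

Theorem corollaryV4 (R : realType) (dA dB dE : nat)
    (rho : 'M[R[i]]_(dA * dB)) (rhoABE : 'M[R[i]]_(dA * (dB * dE))) :
  state rho -> purification rho rhoABE ->
  let eps := symext_dist rho in
  eps <= 1 ->
  (one_way_key rhoABE <=
    (8 * eps * log2 dA%:R + 4 * eta (1 - eps) + 4 * eta eps)%:E)%E.
Proof.
move=> hrho [[v rhoABE_v] marg] eps eps1.
apply: ge_ereal_sup => _ [n [m [Q [W [hQ hW ->]]]]]; rewrite lee_fin.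
have := state_dim_gt0 hrho; rewrite muln_gt0 => /andP[dA0 _].
(* Both alphabets are nonempty, since an empty sum is neither the identity on a nonzero space nor a
   total probability 1. *)
have n0 : (0 < n)%N.
  rewrite lt0n; apply/eqP => n0; have := hQ.2.
  rewrite big1 => [|x _]; last by case: (ord_dim_neq0 x n0).
  move=> /matrixP/(_ (Ordinal dA0) (Ordinal dA0)); rewrite !mxE eqxx => /eqP.
  by rewrite eq_sym oner_eq0.
have m0 : (0 < m)%N.
  rewrite lt0n; apply/eqP => m0; have := hW.2 (Ordinal n0).
  rewrite big1 => [|t _]; last by case: (ord_dim_neq0 t m0).
  by move/eqP; rewrite eq_sym oner_eq0.
have ln2 : 0 < ln (2 : R) by apply: ln_gt0; lra.
rewrite rhoABE_v -adjE (key_gainE v n0 m0 hQ.1 hW) !etaE /log2.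
have -> : 8 * eps * (ln dA%:R / ln 2) + 4 * (xln (1 - eps) / ln 2) +
   4 * (xln eps / ln 2) = (8 * eps * ln dA%:R + 4 * xln (1 - eps) + 4 * xln eps) / ln 2.
  by ring.
rewrite ler_pM2r ?invr_gt0 //.
rewrite rhoABE_v -adjE in marg.
have hM := mixture_POVM hQ hW.
have gapE P : psdmx P -> post_gap v P = condent (@bra R dA dB) (filtered P rho).
  by move=> hP; rewrite (post_gap_condent v hP) marg.
rewrite (eq_bigr _ (fun x _ => gapE _ (hQ.1 x))).
rewrite (eq_bigr _ (fun t _ => gapE _ (hM.1 t))).
exact: key_gain_bound.
Qed.
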